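(* For all constants $\delta>0$, $c\ge1$ and $c_0\ge1$ there is a constant $c_2=c_2(\delta,c,c_0)\ge 1$, depending only on $\delta$, $c$ and $c_0$, such that the following holds. Let $E$ be a real Banach space of dimension at least $2$ and let $D\subsetneq E$ be a $\delta$-Gromov hyperbolic $c$-John domain. Then every $c_0$-quasigeodesic $\gamma\subset D$ is a $c_2$-cone arc.
   Context: $E$ is a real Banach space with norm $|\cdot|$. For a domain $D\subsetneq E$ put $d_D(z)=\operatorname{dist}(z,\partial D)$. $\ell(\gamma)$ denotes the arc length of a curve $\gamma$ with respect to the norm, and $\gamma[u,v]$ denotes the part of $\gamma$ between $u,v\in\gamma$. Quasihyperbolic metric: for a rectifiable arc $\gamma\subset D$, $\ell_k(\gamma)=\int_\gamma \frac{|dz|}{d_D(z)}$; for $z_1,z_2\in D$, $k_D(z_1,z_2)=\inf_\gamma \ell_k(\gamma)$ over all rectifiable arcs $\gamma\subset D$ joining $z_1$ and $z_2$. Quasigeodesic: a curve $\gamma\subset D$ is a $c_0$-quasigeodesic ($c_0\ge1$) if $\ell_k(\gamma[x,y])\le c_0\,k_D(x,y)$ for all $x,y\in\gamma$. Gromov hyperbolic domain: $D\subsetneq E$ is $\delta$-Gromov hyperbolic ($\delta>0$) if for all $x,y,z,p\in D$, $(x|z)_p\ge\min\{(x|y)_p,(y|z)_p\}-\delta$, where $2(x|y)_p=k_D(p,x)+k_D(p,y)-k_D(x,y)$. Cone arcs and John domains: a rectifiable curve $\gamma\subset D$ with end points $z_1,z_2$ is a $c$-cone arc (cone curve, John curve),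 $c\ge 1$, if $\min_{j=1,2}\ell(\gamma[z_j,z])\le c\,d_D(z)$ for all $z\in\gamma$. $D$ is a $c$-John domain if each pair of points in $D$ can be joined by a $c$-cone arc in $D$. *)

(* Defs.v *)
From HB Require Import structures.
From mathcomp Require Import all_boot all_order all_algebra.
From mathcomp Require Import all_classical all_reals all_analysis.

Set Implicit Arguments.
Unset Strict Implicit.
Unset Printing Implicit Defensive.

Import Order.TTheory GRing.Theory Num.Theory.
Import numFieldNormedType.Exports.

Local Open Scope classical_set_scope.
Local Open Scope ring_scope.

(* A curve is a function g : R -> E together with a parameter interval
   `[a, b]; only the values of g on `[a, b] matter.  For s <= t in `[a, b],
   the subcurve g[g s, g t] is g on `[s, t].  Degenerate intervals a = b are
   allowed, so that a point is joined to itself by a constant arc. *)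

Section QuasihyperbolicGeometry.
Context {R : realType} {E : completeNormedModType R}.
Implicit Types (D : set E) (g : R -> E) (a b t u : R) (x y z p : E).

Definition dim_ge2 (V : lmodType R) : Prop :=
  exists v w : V, forall r s : R, r *: v + s *: w = 0 -> r = 0 /\ s = 0.

Definition boundary D : set E := closure D `\` interior D.

Definition domain D : Prop := [/\ D !=set0, open D & connected D].

Definition bdist D z : R := inf [set `|z - w| | w in boundary D].

Definition curve_in D g a b : Prop :=
  [/\ a <= b, {within `[a, b], continuous g} & g @` `[a, b] `<=` D].

Definition arc_in D g a b : Prop :=
  curve_in D g a b /\ {in `[a, b] &, injective g}.

(* The library's total variation is restricted to real-valued functions; this
   is the same supremum for E-valued ones. *)
Definition arc_length g a b : \bar R :=
  ereal_sup [set (\sum_(0 <= i < size s)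
      `|g (nth b (a :: s) i.+1) - g (nth b (a :: s) i)|)%:E
    | s in itv_partition a b].

Definition rectifiable g a b : Prop := (arc_length g a b < +oo)%E.

(* The point of the curve at arc length u from g a. *)
Definition arclength_param g a b u : E :=
  g (inf [set t | t \in `[a, b] /\ (u%:E <= arc_length g a t)%E]).

(* The integral of |dz| / d_D(z) along g, computed in the arc length
   parametrization.  On a nonrectifiable curve in D it ranges over all u >= 0
   and is +oo, since bdist D is bounded on the curve. *)
Definition qh_length D g a b : \bar R :=
  \int[lebesgue_measure]_(u in [set u : R | 0 <= u /\
                                   (u%:E <= arc_length g a b)%E])
    ((bdist D (arclength_param g a b u))^-1)%:E.

(* In a domain the infimum is over a nonempty set of finite lengths, so [fine]
   loses nothing. *)
Definition qh_dist D x y : R :=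
  fine (ereal_inf [set l | exists g a b,
    [/\ arc_in D g a b, rectifiable g a b, g a = x, g b = y
      & l = qh_length D g a b]]).

Definition quasigeodesic D (c0 : R) g a b : Prop :=
  curve_in D g a b /\
  forall s t, a <= s -> s <= t -> t <= b ->
    (qh_length D g s t <= (c0 * qh_dist D (g s) (g t))%:E)%E.

Definition gromov_product D x y p : R :=
  (qh_dist D p x + qh_dist D p y - qh_dist D x y) / 2.

Definition gromov_hyperbolic D (delta : R) : Prop :=
  forall x y z p, D x -> D y -> D z -> D p ->
    Num.min (gromov_product D x y p) (gromov_product D y z p) - delta
      <= gromov_product D x z p.

Definition cone_arc D (c : R) g a b : Prop :=
  [/\ curve_in D g a b, rectifiable g a b
    & forall t, a <= t <= b ->
        (Order.min (arc_length g a t) (arc_length g t b)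
           <= (c * bdist D (g t))%:E)%E].

Definition john D (c : R) : Prop :=
  forall x y, D x -> D y ->
    exists g a b, [/\ cone_arc D c g a b, g a = x & g b = y].

End QuasihyperbolicGeometry.

(* Main.v *)
Require Import Defs.
From HB Require Import structures.
From mathcomp Require Import all_boot all_order all_algebra.
From mathcomp Require Import all_classical all_reals all_analysis.
From mathcomp Require Import measurable_realfun.
From mathcomp Require Import ring lra zify.

Set Implicit Arguments.
Unset Strict Implicit.
Unset Printing Implicit Defensive.

Import Order.TTheory GRing.Theory Num.Theory.
Import numFieldNormedType.Exports.

Local Open Scope classical_set_scope.
Local Open Scope ring_scope.

(* On a half of a c-cone arc, parametrized by the arc length s from its end
   point x, the boundary distance d is comparable to d(x) + s.  Sampled where
   d(x) + s doubles, the half is therefore a discrete quasigeodesic, along which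
   ln d grows linearly.  Let g be a quasigeodesic from x to y and z0 the point
   where the two halves of a cone arc from x to y meet.  By hyperbolicity and
   the stability of quasigeodesics, each point p of g is at bounded
   quasihyperbolic distance from the half ending at x, say, and then so are all
   the points of g before p.  Hence ln d grows linearly along g up to p, and the
   length of that part of g is bounded by a geometric series with largest term
   comparable to d(p).

   Geodesics need not exist in D, so stability is proved for discrete chains, and
   a point of a geodesic [x, y] is replaced by the distance function it would
   have in a tree. *)

(** * Quasigeodesic chains in hyperbolic spaces *)

(** Stability rests on comparing two rates. Along a chain of n points a Gromov product loses about
    [delta] times log2 n, while n is at most linear in the size h of a detour; hence every large
    enough bound on the distance from the geodesic to the chain can be improved. All constants are
    fixed before the space is, so they depend on [delta], [c], [c0] only. The logarithm of the
    boundary distance enters because it is 1-Lipschitz for [qh_dist], a rate that the cone arc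
    attains up to constants. A second obstacle is that [qh_dist] is an infimum over injective arcs,
    a class not closed under concatenation. Only short straight segments are ever appended, after
    cutting the arc at the last point of the segment that it meets. The triangle inequality, the
    symmetry and the Lipschitz bounds then come from integrating locally Lipschitz functions along
    curves. *)

Section HyperbolicChains.
Context {R : realType} {X : Type} (k : X -> X -> R) (delta : R).
Implicit Types (x y z w : X) (p : nat -> X) (f : X -> R).

(** For the products [gprod f] this reads (x|z) >= min((x|y), (y|z)) - [delta]. The function [f]
    replaces the distance to a base point, so that [vpoint x y r] can serve as a base point too. *)
Definition four_point f := forall x y z,
  k x z + f y <= k x y + f z + 2 * delta \/
  k x z + f y <= k y z + f x + 2 * delta.

Definition hyperbolic_dist :=
  [/\ forall x, k x x = 0, forall x y, k x y = k y x,
      forall x y z, k x z <= k x y + k y z & forall w, four_point (k w)].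

(** A discrete quasigeodesic; the opposite bound on [k] follows from the bounded steps
    ([qchain_le]). *)
Definition qchain (S A B : R) p N :=
  (forall i, (i < N)%N -> k (p i) (p i.+1) <= S) /\
  (forall i j, (i <= j <= N)%N -> (j - i)%:R <= A * k (p i) (p j) + B).

(* In a tree, the distance from [w] to the point at distance [r] from [x] on
   the geodesic [x, y].  It stands for such a point when there is no geodesic. *)
Definition vpoint x y r w := Num.max (k x w - r) (k y w - (k x y - r)).

Definition gprod f x y := (f x + f y - k x y) / 2.

Hypothesis delta_gt0 : 0 < delta.
Hypothesis hk : hyperbolic_dist.

Let kxx x : k x x = 0. Proof. by case: hk. Qed.
Let kC x y : k x y = k y x. Proof. by case: hk. Qed.
Let ktri x y z : k x z <= k x y + k y z. Proof. by case: hk. Qed.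
Let k4 w : four_point (k w). Proof. by case: hk. Qed.
Let k_ge0 x y : 0 <= k x y.
Proof. by have := ktri x y x; rewrite kxx (kC y x); lra. Qed.

Lemma vpoint_ge x y r w :
  k x w - r <= vpoint x y r w /\ k y w - (k x y - r) <= vpoint x y r w.
Proof. by rewrite /vpoint !le_max !lexx orbT. Qed.

Lemma vpointP x y r w : vpoint x y r w = k x w - r \/
  vpoint x y r w = k y w - (k x y - r).
Proof. by rewrite /vpoint; case: leP => _; [right|left]. Qed.

(** The condition survives shifts and maxima: at the middle point the maximum equals one of the two
    shifted distances, and at the outer points it dominates that one. *)
Lemma vpoint_four_point x y r : four_point (vpoint x y r).
Proof.
move=> a b c; have [a1 a2] := vpoint_ge x y r a; have [c1 c2] := vpoint_ge x y r c.
by case: (vpointP x y r b) => ->; [have [] := k4 x a b c|have [] := k4 y a b c];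
  move=> h; [left|right|left|right]; lra.
Qed.

Lemma vpoint_left x y r : 0 <= r <= k x y -> vpoint x y r x = r.
Proof.
move=> hr; have [h1 h2] := vpoint_ge x y r x.
by case: (vpointP x y r x) => h; move: h1 h2; rewrite h kxx (kC y x); lra.
Qed.

Lemma vpoint_right x y r : 0 <= r <= k x y -> vpoint x y r y = k x y - r.
Proof.
move=> hr; have [h1 h2] := vpoint_ge x y r y.
by case: (vpointP x y r y) => h; move: h1 h2; rewrite h kxx; lra.
Qed.

Lemma vpoint_lip x y r z w : vpoint x y r z <= vpoint x y r w + k w z.
Proof.
have [h1 h2] := vpoint_ge x y r w; have := ktri x w z; have := ktri y w z.
by case: (vpointP x y r z) => ->; lra.
Qed.

Lemma vpoint_shift x y r s w : vpoint x y r w <= vpoint x y s w + `|r - s|.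
Proof.
have [h1 h2] := vpoint_ge x y s w.
have := ler_norm (r - s); have := ler_norm (s - r); rewrite distrC.
by case: (vpointP x y r w) => ->; lra.
Qed.

(** A triangle inequality through the virtual point: the four-point condition bounds [k z w + k x y]
    by a sum that pairs [z] and [w] with different ends. *)
Lemma vpoint_dist x y r z w :
  k z w <= vpoint x y r z + vpoint x y r w + 2 * delta.
Proof.
have [h1 h2] := vpoint_ge x y r w; have [h3 h4] := vpoint_ge x y r z.
by have := k4 x z y w; rewrite (kC z y) => -[]; lra.
Qed.

(** Halving the chain costs one [delta] per level, hence a loss logarithmic in the number of steps;
    proceeding step by step would lose a linear amount. *)
Lemma gprod_chain f p (h : R) (m n : nat) : four_point f -> (0 < n <= 2 ^ m)%N ->
  (forall i, (i < n)%N -> h <= gprod f (p i) (p i.+1)) ->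
  h - m%:R * delta <= gprod f (p 0) (p n).
Proof.
move=> f4; elim: m n p => [|m IH] n p.
  rewrite expn0 => n1 hp; have -> : n = 1%N by lia.
  by rewrite mul0r subr0; apply: hp; lia.
move=> n2 hp; have [nm|mn] := leqP n (2 ^ m).
  by have := IH n p ltac:(lia) hp; have := delta_gt0; rewrite -natr1; lra.
have [n' en] : exists n', (n = 2 ^ m + n')%N by exists (n - 2 ^ m)%N; lia.
have m0 : (0 < 2 ^ m)%N by rewrite expn_gt0.
have h1 := IH (2 ^ m)%N p ltac:(lia) ltac:(move=> i hi; apply: hp; lia).
have := IH n' (fun i => p (2 ^ m + i)%N).
move=> /(_ ltac:(rewrite expnS in n2; lia)) h2.
have {}h2 := h2 ltac:(move=> i hi; rewrite addnS; apply: hp; lia).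
move: h2 h1; rewrite addn0 -en /gprod -[m.+1%:R]natr1.
by have [] := f4 (p 0) (p (2 ^ m)%N) (p n); lra.
Qed.

(** Coarse form of: the geodesic from [p 0] to [p N] stays within [h] of the chain. *)
Definition reaches p N (h : R) := forall r, 0 <= r <= k (p 0) (p N) ->
  exists2 i, (i <= N)%N & vpoint (p 0) (p N) r (p i) <= h.

Lemma reaches_dist p N : reaches p N (k (p 0) (p N)).
Proof. by move=> r hr; exists 0 => //; rewrite vpoint_left//; lra. Qed.

Lemma reachesW p N (h h' : R) : h <= h' -> reaches p N h -> reaches p N h'.
Proof. by move=> hh H r /H[i iN ih]; exists i => //; lra. Qed.

(** A chain point near the virtual point at [r - 2 * h] lies on the same side of the one at [r] as
    [p 0] does, which the large Gromov product expresses. If there is no room for this, [p 0] itself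
    serves, with product [r]. *)
Lemma reaches_left p N (h r : R) : 0 <= h -> reaches p N h ->
  0 <= r <= k (p 0) (p N) -> exists2 i, (i <= N)%N &
    vpoint (p 0) (p N) r (p i) <= 3 * h /\
    (h <= gprod (vpoint (p 0) (p N) r) (p 0) (p i) \/
     r <= gprod (vpoint (p 0) (p N) r) (p 0) (p i)).
Proof.
move=> h0 H hr; have [rh|hr2] := ltP r (2 * h).
  exists 0 => //; rewrite /gprod vpoint_left// kxx.
  by split; [lra|right; lra].
have [|i iN ih] := H (r - 2 * h); first by lra.
exists i => //; have [h1 h2] := vpoint_ge (p 0) (p N) r (p i).
have [h3 h4] := vpoint_ge (p 0) (p N) (r - 2 * h) (p i).
have := vpoint_shift (p 0) (p N) r (r - 2 * h) (p i).
have -> : r - (r - 2 * h) = 2 * h by lra.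
rewrite ger0_norm; last by lra.
have := ktri (p 0) (p i) (p N); rewrite (kC (p i)).
by rewrite /gprod vpoint_left// => ? ?; split; [lra|left; lra].
Qed.

Lemma reaches_right p N (h r : R) : 0 <= h -> reaches p N h ->
  0 <= r <= k (p 0) (p N) -> exists2 i, (i <= N)%N &
    vpoint (p 0) (p N) r (p i) <= 3 * h /\
    (h <= gprod (vpoint (p 0) (p N) r) (p i) (p N) \/
     k (p 0) (p N) - r <= gprod (vpoint (p 0) (p N) r) (p i) (p N)).
Proof.
move=> h0 H hr; have [rh|hr2] := ltP (k (p 0) (p N) - r) (2 * h).
  exists N => //; rewrite /gprod vpoint_right// kxx.
  by split; [lra|right; lra].
have [|i iN ih] := H (r + 2 * h); first by lra.
exists i => //; have [h1 h2] := vpoint_ge (p 0) (p N) r (p i).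
have [h3 h4] := vpoint_ge (p 0) (p N) (r + 2 * h) (p i).
have := vpoint_shift (p 0) (p N) r (r + 2 * h) (p i).
have -> : r - (r + 2 * h) = - (2 * h) by lra.
rewrite normrN ger0_norm; last by lra.
have := ktri (p 0) (p i) (p N); have := kC (p i) (p N).
by rewrite /gprod vpoint_right// => ? ? ?; split; [lra|left; lra].
Qed.

Lemma gprodC f x y : gprod f x y = gprod f y x.
Proof. by rewrite /gprod kC (addrC (f x)). Qed.

Section Chain.
Variables (S A B : R).
Hypotheses (S_ge0 : 0 <= S) (A_ge0 : 0 <= A) (B_ge0 : 0 <= B).

Lemma qchain_sub p N i j : (i <= j <= N)%N -> qchain S A B p N ->
  qchain S A B (fun l => p (i + l)%N) (j - i).
Proof.
move=> ijN [p1 p2]; split=> [l hl|l l' hl].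
  by rewrite addnS; apply: p1; lia.
by rewrite -(subnDl i); apply: p2; lia.
Qed.

Lemma qchain_le p N i j : qchain S A B p N -> (i <= j <= N)%N ->
  k (p i) (p j) <= S * (j - i)%:R.
Proof.
move=> [p1 _] /andP[/subnKC <-]; rewrite addKn.
elim: (j - i)%N => [|n IH] hn; first by rewrite addn0 kxx mulr0.
have := ktri (p i) (p (i + n)%N) (p (i + n.+1)%N).
have := IH ltac:(lia); have := p1 (i + n)%N ltac:(lia).
by rewrite addnS -natr1; lra.
Qed.

Lemma vpoint_gprod_chain p N i j (x y : X) (r h : R) (m : nat) :
  qchain S A B p N -> (i <= j <= N)%N -> (j - i <= 2 ^ m)%N ->
  (forall l, (l <= N)%N -> h < vpoint x y r (p l)) ->
  h - S / 2 - m%:R * delta <= gprod (vpoint x y r) (p i) (p j).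
Proof.
move=> [p1 _] /andP[ij jN] ijm ph; have [eij|nij] := eqVneq i j.
  rewrite eij /gprod kxx; have := ph j jN; have : 0 <= m%:R * delta.
    by rewrite mulr_ge0// ltW.
  by have := S_ge0; lra.
have := @gprod_chain (vpoint x y r) (fun l => p (i + l)%N) (h - S / 2) m (j - i)%N.
rewrite addn0 subnKC//; apply.
- exact: vpoint_four_point.
- by lia.
- move=> l hl; have := ph (i + l)%N ltac:(lia); have := ph (i + l.+1)%N ltac:(lia).
  by have := p1 (i + l)%N ltac:(lia); rewrite /gprod addnS; lra.
Qed.

(** If the chain avoided a virtual point, take chain points [p i], [p j] on its two sides. They are
    at distance at most [6 * h + 2 * delta], so at most [2 ^ m] steps separate them, and
    [gprod_chain] along these steps keeps their Gromov product large. *)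
Lemma reaches_improve p N (h : R) (m : nat) : qchain S A B p N -> 0 <= h ->
  A * (6 * h + 2 * delta) + B <= (2 ^ m)%:R ->
  S / 2 + (m%:R + 2) * delta + 1 <= h ->
  reaches p N h -> reaches p N (S / 2 + (m%:R + 2) * delta + 1).
Proof.
move=> qp h0 hm hh H r hr; have S0 := S_ge0; have d0 := delta_gt0; set h' := S / 2 + _ + 1 in hh *.
apply: contrapT => /forall2NP nH.
have {}nH l : (l <= N)%N -> h' < vpoint (p 0) (p N) r (p l).
  by move=> lN; case: (nH l) => // /negP; rewrite -ltNge.
have [i iN [i1 i2]] := reaches_left h0 H hr.
have [j jN [j1 j2]] := reaches_right h0 H hr.
have := nH 0 isT; have := nH N (leqnn _); rewrite vpoint_left// vpoint_right//.
move=> hN h1.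
have ij : h' - S / 2 - m%:R * delta <= gprod (vpoint (p 0) (p N) r) (p i) (p j).
  have kij := vpoint_dist (p 0) (p N) r (p i) (p j).
  have near i' j' : (i' <= j' <= N)%N -> k (p i') (p j') = k (p i) (p j) ->
    (j' - i' <= 2 ^ m)%N.
    move=> /(qp.2 i' j') + e; rewrite e -(ler_nat R) => le.
    apply: (le_trans le); apply: le_trans hm; rewrite lerD2r.
    by rewrite ler_wpM2l//; lra.
  have [ij|ji] := leqP i j.
    have ijN : (i <= j <= N)%N by rewrite ij.
    exact: (vpoint_gprod_chain qp ijN (near _ _ ijN erefl) nH).
  have jiN : (j <= i <= N)%N by rewrite ltnW.
  by rewrite gprodC; exact: (vpoint_gprod_chain qp jiN (near _ _ jiN (kC _ _)) nH).
(* Seen from the virtual point, [p 0] and [p N] have Gromov product 0. Passing through [p i] and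
   [p j] would make it at least 1: the [2 * delta] in [h'] pays for these two steps, and the final 1
   gives the contradiction. *)
have := vpoint_four_point (p 0) (p N) r (p 0) (p i) (p j).
have := vpoint_four_point (p 0) (p N) r (p 0) (p j) (p N).
move: i2 j2 ij; rewrite /gprod vpoint_left// vpoint_right//.
have h'E : h' = S / 2 + (m%:R + 2) * delta + 1 by [].
have md : 0 <= m%:R * delta by rewrite mulr_ge0// ltW.
move: h'E; clearbody h' => h'E.
by move=> [] ? [] ? ? [] ? [] ?; lra.
Qed.

(** The descent starts at the distance between the ends, a bound that depends on the chain, and
    gains at least 1 per improvement as long as the bound is at least [h0]. *)
Lemma reaches_descend p N (h0 : R) : qchain S A B p N -> 0 <= h0 ->
  (forall h, h0 <= h -> exists m : nat,
     A * (6 * h + 2 * delta) + B <= (2 ^ m)%:R /\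
     S / 2 + (m%:R + 2) * delta + 1 <= h - 1) ->
  reaches p N h0.
Proof.
move=> qp h00 hm.
have H n : reaches p N (h0 + n%:R) -> reaches p N h0.
  elim: n => [|n IH]; first by rewrite addr0.
  move=> Hn; apply: IH; have n0 : 0 <= n%:R :> R by [].
  have [m [m1 m2]] := hm (h0 + n.+1%:R) ltac:(rewrite -[n.+1%:R]natr1; lra).
  rewrite -[n.+1%:R]natr1 in m1 m2 Hn.
  by apply: (reachesW _ (reaches_improve qp _ m1 _ Hn)); lra.
apply: (H (Num.truncn (k (p 0) (p N))).+1).
have kN := truncnS_gt (k (p 0) (p N)).
by apply: (reachesW _ (@reaches_dist p N)); lra.
Qed.

(** Discrete connectedness: moving along the geodesic by unit steps, the virtual points are first
    reached by indices up to [l] and eventually by later ones. At the switch, indices on both sides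
    of [l] reach virtual points at most 1 apart, so few steps separate them and [p l] is near
    both. *)
Lemma qchain_gprod p N (h : R) l : qchain S A B p N -> 0 <= h ->
  reaches p N h -> (l <= N)%N ->
  k (p 0) (p l) + k (p l) (p N) - k (p 0) (p N) <=
    2 * (h + S * (A * (2 * h + 1 + 2 * delta) + B)).
Proof.
move=> qp h0 H lN; have d0 := delta_gt0; set x := p 0; set y := p N; set T := k x y.
pose P (s : nat) := exists2 i, (i <= l)%N & vpoint x y (Num.min s%:R T) (p i) <= h.
have T0 : 0 <= T by exact: k_ge0.
have key r r' i j : (i <= l <= j)%N -> (j <= N)%N -> `|r - r'| <= 1 ->
    vpoint x y r (p i) <= h -> vpoint x y r' (p j) <= h ->
    k x (p l) + k (p l) y - T <=
    2 * (h + S * (A * (2 * h + 1 + 2 * delta) + B)).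
  move=> /andP[il lj] jN rr hi hj.
  have [h1 h2] := vpoint_ge x y r (p l); rewrite (kC y) -/T in h2.
  suff : vpoint x y r (p l) <= h + S * (A * (2 * h + 1 + 2 * delta) + B) by lra.
  apply: le_trans (vpoint_lip x y r (p l) (p i)) _; apply: lerD => //.
  have ilN : (i <= l <= N)%N by rewrite il.
  have ijN : (i <= j <= N)%N by rewrite (leq_trans il).
  apply: le_trans (qchain_le qp ilN) _; rewrite ler_wpM2l//.
  have lij : (l - i)%:R <= (j - i)%:R :> R by rewrite ler_nat leq_sub2r.
  apply: (le_trans lij); apply: le_trans (qp.2 i j ijN) _.
  rewrite lerD2r ler_wpM2l//.
  by have := vpoint_dist x y r (p i) (p j); have := vpoint_shift x y r r' (p j); lra.
have [Pall|/existsNP] := pselect (forall s, P s).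
  have [i il ih] := Pall (Num.truncn T).+1.
  apply: (key T T i N); rewrite ?il ?lN ?subrr ?normr0//.
    by move: ih; rewrite min_r//; have := truncnS_gt T; lra.
  by rewrite vpoint_right// ?T0 ?lexx// -/T subrr.
case=> s0; elim: s0 => [|s IH] nP.
  case: nP; exists 0 => //.
  by rewrite min_l// vpoint_left ?lexx.
have [[i il ih]|/IH//] := pselect (P s).
have [] := H (Num.min s.+1%:R T).
  by rewrite le_min ler0n T0 ge_min lexx orbT.
move=> j jN hj; apply: (key _ _ i j _ jN _ ih hj).
  rewrite il/= ltnW// ltnNge; apply/negP => jl; apply: nP; by exists j.
rewrite ler_norml -[s.+1%:R]natr1.
by case: (leP s%:R T); case: (leP (s%:R + 1) T) => h1 h2; apply/andP; split; lra.
Qed.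

End Chain.
End HyperbolicChains.

(** * Stability with constants independent of the space *)

Lemma linear_le_exp (R : realType) (a b : R) : 0 <= a -> 0 <= b ->
  exists m0 : nat, forall m : nat, (m0 <= m)%N -> a + b * m%:R <= (2 ^ m)%:R.
Proof.
move=> a0 b0; exists (Num.truncn (4 * (a + b))).+1 => m m0.
have hm : 4 * (a + b) < m%:R.
  by apply: lt_le_trans (truncnS_gt _) _; rewrite ler_nat.
have : (m * m.+1 <= 4 * 2 ^ m)%N.
  elim: {m0 hm} m => // m IH; have := ltn_expl m (isT : (1 < 2)%N).
  by rewrite expnS; lia.
rewrite -(ler_nat R) !natrM -[m.+1%:R]natr1 => hm2.
have m1 : 0 <= m%:R :> R by [].
have : 4 * (a + b) * (m%:R + 1) <= m%:R * (m%:R + 1).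
  by rewrite ler_wpM2r//; lra.
have := mulr_ge0 a0 m1; nra.
Qed.

(** The second inequality says [m%:R * delta <= h - c]; take the largest such [m]. Then [h] is below
    [c + delta * (m%:R + 1)], and the first inequality compares a linear function of [m] with
    [2 ^ m]. *)
Lemma descent_threshold (R : realType) (delta S A B : R) : 0 < delta ->
  0 <= S -> 0 <= A -> 0 <= B ->
  exists2 h0 : R, 0 <= h0 & forall h, h0 <= h -> exists m : nat,
     A * (6 * h + 2 * delta) + B <= (2 ^ m)%:R /\
     S / 2 + (m%:R + 2) * delta + 1 <= h - 1.
Proof.
move=> d0 S0 A0 B0; pose c := S / 2 + 2 * delta + 2.
have [||m0 hm0] := @linear_le_exp R (A * (6 * (c + delta) + 2 * delta) + B)
    (A * (6 * delta)).
- by rewrite addr_ge0// mulr_ge0// /c; lra.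
- by rewrite mulr_ge0//; lra.
exists (c + delta * m0%:R); first by rewrite /c addr_ge0 ?mulr_ge0//; lra.
move=> h hh; have dm0 : 0 <= delta * m0%:R by rewrite mulr_ge0// ltW.
have q0 : 0 <= (h - c) / delta by rewrite divr_ge0//; lra.
have := truncn_itv q0; set m := Num.truncn _ => /andP[m1 m2]; exists m.
move: m1 m2; rewrite ler_pdivlMr// ltr_pdivrMr// -[m.+1%:R]natr1 => m1 m2.
split; last by rewrite /c in m1; lra.
have /hm0 : (m0 <= m)%N.
  rewrite -ltnS -(ltr_nat R) -[m.+1%:R]natr1.
  have : m0%:R * delta < (m%:R + 1) * delta by lra.
  by rewrite ltr_pM2r.
apply: le_trans; rewrite -addrA [B + _]addrC addrA lerD2r -mulrA -mulrDr.
by rewrite ler_wpM2l//; lra.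
Qed.

(** Subchains satisfy the same chain condition, so the bound [H] on backtracking holds between any
    two indices. *)
Lemma morse (R : realType) (delta S A B : R) : 0 < delta ->
  0 <= S -> 0 <= A -> 0 <= B ->
  exists D H : R, [/\ 0 <= D, 0 <= H &
    forall (X : Type) (k : X -> X -> R), hyperbolic_dist k delta ->
    forall p N, qchain k S A B p N -> reaches k p N D /\
      forall i l j, (i <= l <= j)%N -> (j <= N)%N ->
        k (p i) (p l) + k (p l) (p j) - k (p i) (p j) <= H].
Proof.
move=> d0 S0 A0 B0; have [D D0 hD] := descent_threshold d0 S0 A0 B0.
exists D, (2 * (D + S * (A * (2 * D + 1 + 2 * delta) + B))); split=> //.
  by rewrite mulr_ge0// addr_ge0// mulr_ge0// addr_ge0// mulr_ge0//; lra.
move=> X k hk p N qp; split; first exact: (reaches_descend d0 hk S0 A0 B0 qp).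
move=> i l j ilj jN.
have qp' : qchain k S A B (fun l => p (i + l)%N) (j - i).
  by apply: qchain_sub qp; lia.
have := qchain_gprod d0 hk S0 A0 B0 qp' D0 (reaches_descend d0 hk S0 A0 B0 qp' D0 hD).
by move=> /(_ (l - i)%N); rewrite addn0 !subnKC; [apply; lia|lia..].
Qed.

(** * Chains along which a Lipschitz function grows *)

Section GrowthChains.
Context {R : realType} {X : Type} (k : X -> X -> R) (rho : X -> R).

Definition gchain (S A B : R) (w : nat -> X) n :=
  (forall i, (i < n)%N -> k (w i) (w i.+1) <= S) /\
  (forall i j, (i <= j <= n)%N -> (j - i)%:R <= A * (rho (w j) - rho (w i)) + B).

Lemma gchain_qchain S A B w n : 0 <= A ->
  (forall x y, rho y - rho x <= k x y) -> gchain S A B w n -> qchain k S A B w n.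
Proof.
move=> A0 hrho [w1 w2]; split=> // i j ij; apply: (le_trans (w2 i j ij)).
by rewrite lerD2r ler_wpM2l.
Qed.

Lemma qchain_rev (S A B : R) p N : (forall x y, k x y = k y x) ->
  qchain k S A B p N -> qchain k S A B (fun i => p (N - i)%N) N.
Proof.
move=> kC [p1 p2]; split=> [i iN|i j ij].
  rewrite kC; have -> : (N - i = (N - i.+1).+1)%N by lia.
  by apply: p1; lia.
have -> : (j - i = (N - i) - (N - j))%N by lia.
by rewrite kC; apply: p2; lia.
Qed.
End GrowthChains.

(* If the quasigeodesic [p] passes near the geodesic from [p 0] to [z0] at [p l],
   then all of [p 0, .., p l] stays near that geodesic, along which [rho] grows. *)
Lemma one_sided_growth (R : realType) (delta S A B G : R) : 0 < delta ->
  0 < S -> 0 < A -> 0 <= B -> 0 <= G ->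
  exists A' B' : R, [/\ 0 < A', 0 <= B' &
    forall (X : Type) (k : X -> X -> R) (rho : X -> R), hyperbolic_dist k delta ->
    (forall x y, rho y - rho x <= k x y) ->
    forall p N w n, qchain k S A B p N -> gchain k rho S A B w n -> w 0%N = p 0%N ->
    forall l, (l <= N)%N ->
      k (p 0%N) (p l) + k (p l) (w n) - k (p 0%N) (w n) <= G ->
    forall j, (j <= l)%N -> (l - j)%:R <= A' * (rho (p l) - rho (p j)) + B'].
Proof.
move=> d0 S0 A0 B0 G0.
have [D [H [D0 H0 hm]]] := morse d0 (ltW S0) (ltW A0) B0.
(* [e] bounds the distance from [p i] to the growth chain. [A'] composes three linear bounds: the
   index difference by the distance, the distance by the number of steps along [w], and that number
   by the growth of [rho]. *)
pose e := D + H + G + 2 * delta; pose A' := A * S * A.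
have e0 : 0 <= e by rewrite /e; lra.
have A'0 : 0 < A' by rewrite !mulr_gt0.
have A1 := ltW A0; have S1 := ltW S0; have A'1 := ltW A'0.
have SAe : 0 <= A * (2 * e + S * (A * (2 * e) + B)).
  have Ae : 0 <= A * e by rewrite mulr_ge0.
  have ASAe : 0 <= A' * e by rewrite mulr_ge0.
  have ASB : 0 <= A * S * B by rewrite !mulr_ge0.
  by rewrite /A' in ASAe; lra.
have AH : 0 <= A * (2 * H + 2 * e) by rewrite mulr_ge0//; lra.
have A'H : 0 <= A' * (2 * H + 2 * e) by rewrite mulr_ge0//; lra.
exists A', (A * (2 * e + S * (A * (2 * e) + B)) + B + A' * (2 * H + 2 * e)
            + A * (2 * H + 2 * e)).
split=> //; first by lra.
move=> X k rho hk hrho p N w n qp gw w0 l lN hl j jl.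
have [kxx kC ktri k4] := hk.
have k_ge0 x y : 0 <= k x y by have := ktri x y x; rewrite kxx (kC y x); lra.
have qw := gchain_qchain (ltW A0) hrho gw.
have [rw Hw] := hm _ _ hk _ _ qw; have [_ Hp] := hm _ _ hk _ _ qp.
have near i : (i <= l)%N -> exists2 i', (i' <= n)%N & k (p i) (w i') <= e.
  move=> il; have h1 := Hp 0%N i l il lN.
  have h2 : k (p 0%N) (p i) + k (p i) (w n) - k (p 0%N) (w n) <= H + G.
    by have := ktri (p i) (p l) (w n); lra.
  pose r := Num.min (k (p 0%N) (p i)) (k (p 0%N) (w n)).
  have [|i' i'n hi'] := rw r.
    by rewrite w0 /r le_min !k_ge0 ge_min lexx orbT.
  exists i' => //; move: hi'; rewrite w0 => hi'.
  have := vpoint_dist hk (p 0%N) (w n) r (p i) (w i').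
  suff : vpoint k (p 0%N) (w n) r (p i) <= H + G by rewrite /e; lra.
  have := ktri (p 0%N) (w n) (p i); have := kC (w n) (p i).
  have := k_ge0 (w n) (p i).
  by case: (vpointP k (p 0%N) (w n) r (p i)) => ->; rewrite /r;
    case: (leP (k (p 0%N) (p i)) (k (p 0%N) (w n))); lra.
have [a an ha] := near j jl; have [b bn hb] := near l (leqnn l).
have jlN : (j <= l <= N)%N by rewrite jl.
have lj := qp.2 j l jlN; set rr := rho (p l) - rho (p j).
have rholj : rho (w b) - rho (w a) <= rr + 2 * e.
  have := hrho (w a) (p j); have := hrho (p l) (w b).
  by rewrite (kC (w a)) /rr; lra.
have [ab|ba] := leqP a b.
  have abn : (a <= b <= n)%N by rewrite ab.
  have h4 := gw.2 a b abn; have h3 := qchain_le d0 hk S1 A1 B0 qw abn.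
  have := ktri (p j) (w a) (p l); have := ktri (w a) (w b) (p l).
  rewrite (kC (w b)) => h1 h2.
  have h5 : k (p j) (p l) <= 2 * e + S * (A * (rr + 2 * e) + B).
    have : S * (b - a)%:R <= S * (A * (rr + 2 * e) + B).
      rewrite ler_wpM2l//; apply: (le_trans h4); rewrite lerD2r.
      by rewrite ler_wpM2l.
    by lra.
  have h6 : A * k (p j) (p l) <= A * (2 * e + S * (A * (rr + 2 * e) + B)).
    by rewrite ler_wpM2l.
  by rewrite /A' in A'H *; lra.
(* The nearby points occur in reverse order along [w]. Neither chain backtracks by more than [H], so
   [p j] and [p l] are at bounded distance and the additive constant absorbs this case. *)
have h1 := Hp 0%N j l jl lN; have h2 := Hw 0%N b a (ltnW ba) an.
have h3 : k (p j) (p l) <= 2 * H + 2 * e.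
  have := ktri (p 0%N) (w b) (p l); have := ktri (p 0%N) (p j) (w a).
  by have := k_ge0 (w b) (w a); rewrite (kC (w b) (p l)) -w0; rewrite -w0 in h1; lra.
have h4 : A * k (p j) (p l) <= A * (2 * H + 2 * e) by rewrite ler_wpM2l.
have h5 : 0 <= A' * (rr + (2 * H + 2 * e)).
  by rewrite mulr_ge0//; have := hrho (p l) (p j); rewrite (kC (p l)) /rr; lra.
by lra.
Qed.

(** In the triangle with vertices [p 0], [p N] and [w n], the point [p l] lies near the first side,
    hence near one of the other two by the four-point condition seen from [p l]. Reversing [p]
    reduces the second case to the first. *)
Theorem tripod_growth (R : realType) (delta S A B : R) : 0 < delta ->
  0 < S -> 0 < A -> 0 <= B ->
  exists A' B' : R, [/\ 0 < A', 0 <= B' &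
    forall (X : Type) (k : X -> X -> R) (rho : X -> R), hyperbolic_dist k delta ->
    (forall x y, rho y - rho x <= k x y) ->
    forall p N w n w' n', qchain k S A B p N ->
    gchain k rho S A B w n -> w 0%N = p 0%N ->
    gchain k rho S A B w' n' -> w' 0%N = p N -> w n = w' n' ->
    forall l, (l <= N)%N ->
    (forall j, (j <= l)%N ->
       (l - j)%:R <= A' * (rho (p l) - rho (p j)) + B') \/
    (forall j, (l <= j <= N)%N ->
       (j - l)%:R <= A' * (rho (p l) - rho (p j)) + B')].
Proof.
move=> d0 S0 A0 B0.
have subnB2 (a b c : nat) : (a <= b <= c)%N -> (c - a - (c - b) = b - a)%N by lia.
have [D [H [D0 H0 hm]]] := morse d0 (ltW S0) (ltW A0) B0.
have G0 : 0 <= H + 2 * delta by lra.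
have [A' [B' [A'0 B'0 hg]]] := one_sided_growth d0 S0 A0 B0 G0.
exists A', B'; split=> // X k rho hk hrho p N w n w' n' qp gw w0 gw' w'N ww' l lN.
have [_ Hp] := hm _ _ hk _ _ qp; have [kxx kC ktri k4] := hk.
have := Hp 0%N l N lN (leqnn _); have := k4 (p l) (p 0%N) (w n) (p N).
move=> [] h4 h; [left|right].
  move=> j jl; apply: (hg _ _ _ hk hrho _ _ _ _ qp gw w0) => //.
  by lra.
move=> j /andP[lj jN]; have qp' := qchain_rev kC qp.
have := hg _ _ _ hk hrho _ _ _ _ qp' gw'.
rewrite subn0 => /(_ w'N (N - l)%N (leq_subr _ _)).
rewrite subKn// -ww' => hj.
have := hj _ (N - j)%N; rewrite subKn// subnB2 ?lj//.
apply; last by rewrite leq_sub2l.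
by have := kC (p N) (p l); have := kC (w n) (p N); have := kC (p l) (p 0%N); lra.
Qed.

(** * Arc length *)

Section ArcLength.
Context {R : realType} {E : completeNormedModType R}.
Implicit Types (g h : R -> E) (a b c m t u x y : R) (s : seq R).

Fixpoint chord_sum g x s : R :=
  if s is y :: s' then `|g y - g x| + chord_sum g y s' else 0.

Lemma chord_sumE g b x s :
  \sum_(0 <= i < size s) `|g (nth b (x :: s) i.+1) - g (nth b (x :: s) i)|
  = chord_sum g x s.
Proof.
elim: s x => [|y s IH] x /=; first by rewrite big_geq.
by rewrite big_nat_recl//= IH.
Qed.

Lemma arc_lengthE g a b :
  arc_length g a b = ereal_sup [set (chord_sum g a s)%:E | s in itv_partition a b].
Proof.
by congr ereal_sup; apply/seteqP; split => x [s ps <-]; exists s => //;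
  rewrite chord_sumE.
Qed.

Lemma chord_sum_le g a b s : itv_partition a b s ->
  ((chord_sum g a s)%:E <= arc_length g a b)%E.
Proof. by move=> ps; rewrite arc_lengthE; apply: ereal_sup_ubound; exists s. Qed.

Lemma arc_length_le g a b (l : \bar R) :
  (forall s, itv_partition a b s -> ((chord_sum g a s)%:E <= l)%E) ->
  (arc_length g a b <= l)%E.
Proof. by move=> h; rewrite arc_lengthE; apply: ge_ereal_sup => _ [s ps <-]; exact: h. Qed.

Lemma chord_le_arc_length g a b : a <= b -> (`|g b - g a|%:E <= arc_length g a b)%E.
Proof.
rewrite le_eqVlt => /predU1P[->|ab].
  by rewrite subrr normr0; apply: (@chord_sum_le g b b [::]); split=> //=.
have := chord_sum_le g (itv_partition1 ab); rewrite /= addr0; exact.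
Qed.

Lemma arc_length_ge0 g a b : a <= b -> (0 <= arc_length g a b)%E.
Proof. by move=> /(chord_le_arc_length g); apply: le_trans; rewrite lee_fin. Qed.

Lemma arc_length_xx g a : arc_length g a a = 0%E.
Proof.
apply/eqP; rewrite eq_le arc_length_ge0// andbT.
by apply: arc_length_le => s /itv_partitionxx ->.
Qed.

Lemma chord_sum_cat g a s1 s2 :
  chord_sum g a (s1 ++ s2) = chord_sum g a s1 + chord_sum g (last a s1) s2.
Proof. by elim: s1 a => [|y s IH] a /=; rewrite ?add0r// IH addrA. Qed.

Lemma chord_sum_ge0 g a s : 0 <= chord_sum g a s.
Proof. by elim: s a => //= y s IH a; rewrite addr_ge0. Qed.

Lemma itv_partition_ex a b : a <= b -> exists s, itv_partition a b s.
Proof.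
rewrite le_eqVlt => /predU1P[->|/itv_partition1 ab]; last by exists [:: b].
by exists [::]; split=> //=.
Qed.

Lemma chord_sum2_le g a m b s1 s2 : itv_partition a m s1 -> itv_partition m b s2 ->
  ((chord_sum g a s1 + chord_sum g m s2)%:E <= arc_length g a b)%E.
Proof.
move=> p1 p2; have := chord_sum_le g (itv_partition_cat p1 p2).
by rewrite chord_sum_cat; case: p1 => _ /eqP ->.
Qed.

Lemma arc_length_lel g a m b : a <= m -> m <= b ->
  (arc_length g a m <= arc_length g a b)%E.
Proof.
move=> am mb; have [s2 p2] := itv_partition_ex mb.
apply: arc_length_le => s1 p1; apply: le_trans (chord_sum2_le g p1 p2).
by rewrite lee_fin lerDl chord_sum_ge0.
Qed.

Lemma arc_length_ler g a m b : a <= m -> m <= b ->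
  (arc_length g m b <= arc_length g a b)%E.
Proof.
move=> am mb; have [s1 p1] := itv_partition_ex am.
apply: arc_length_le => s2 p2; apply: le_trans (chord_sum2_le g p1 p2).
by rewrite lee_fin lerDr chord_sum_ge0.
Qed.

(** The two suprema are taken one at a time, each time moving the other term across the inequality;
    this requires finite lengths, and an infinite total is trivial. *)
Lemma arc_length_superadd g a m b : a <= m -> m <= b ->
  (arc_length g a m + arc_length g m b <= arc_length g a b)%E.
Proof.
move=> am mb; have [->|labNy] := eqVneq (arc_length g a b) +oo%E.
  by rewrite leey.
have lab : (arc_length g a b < +oo)%E by rewrite ltey.
have fin1 : arc_length g a m \is a fin_num.
  by rewrite ge0_fin_numE ?arc_length_ge0// (le_lt_trans (arc_length_lel g am mb)).
have fin2 : arc_length g m b \is a fin_num.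
  by rewrite ge0_fin_numE ?arc_length_ge0// (le_lt_trans (arc_length_ler g am mb)).
have fin : arc_length g a b \is a fin_num.
  by rewrite ge0_fin_numE// arc_length_ge0// (le_trans am).
rewrite -leeBrDr//; apply: arc_length_le => s1 p1.
rewrite -(fineK fin) -(fineK fin2) -EFinB lee_fin lerBrDr addrC -lerBrDr.
rewrite -lee_fin fineK//; apply: arc_length_le => s2 p2.
by have := chord_sum2_le g p1 p2; rewrite -(fineK fin) !lee_fin; lra.
Qed.

(** Inserting [m] into a partition can only increase the chord sum. *)
Lemma chord_sum_split g a m b s : a <= m -> m <= b -> itv_partition a b s ->
  exists s1 s2, [/\ itv_partition a m s1, itv_partition m b s2 &
    chord_sum g a s <= chord_sum g a s1 + chord_sum g m s2].
Proof.
elim: s a => [|y s IH] a am mb ps.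
  have ab := itv_partition_nil ps; have ma : m = a by apply/le_anti; rewrite am andbT ab mb.
  by exists [::], [::]; rewrite ma -ab; split; rewrite /itv_partition/= ?addr0.
have := ps; rewrite /itv_partition/= => -[/andP[ay pys] lb].
move: am; rewrite le_eqVlt => /predU1P[<-|am].
  by exists [::], (y :: s); rewrite add0r; split; rewrite /itv_partition//=.
have [my|ym] := ltP m y.
  exists [:: m], (y :: s); split; first by split; rewrite //= am.
    by split; rewrite //= my.
  by rewrite /= addr0 addrA lerD2r addrC; apply: ler_distD.
have [s1 [s2 [p1 p2 h]]] := IH y ym mb (itv_partition_cons ps).
exists (y :: s1), s2; split=> //; last by rewrite /= -addrA lerD2l.
by case: p1 => p1 l1; split; rewrite //= ay.
Qed.

Lemma arc_length_subadd g a m b : a <= m -> m <= b ->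
  (arc_length g a b <= arc_length g a m + arc_length g m b)%E.
Proof.
move=> am mb; apply: arc_length_le => s ps.
have [s1 [s2 [p1 p2 h]]] := chord_sum_split g am mb ps.
apply: (@le_trans _ _ (chord_sum g a s1 + chord_sum g m s2)%:E); first by rewrite lee_fin.
by rewrite EFinD; apply: leeD; exact: chord_sum_le.
Qed.

Lemma arc_lengthD g a m b : a <= m -> m <= b ->
  (arc_length g a b = arc_length g a m + arc_length g m b)%E.
Proof.
by move=> am mb; apply/le_anti; rewrite arc_length_subadd ?arc_length_superadd.
Qed.

Lemma arc_length_lip g a b (K : R) : a <= b ->
  (forall x y, a <= x -> x <= y -> y <= b -> `|g y - g x| <= K * (y - x)) ->
  (arc_length g a b <= (K * (b - a))%:E)%E.
Proof.
move=> ab hK; apply: arc_length_le => s; rewrite lee_fin.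
elim: s a {ab} hK => [|y s IH] a hK ps.
  by rewrite (itv_partition_nil ps) subrr mulr0.
have yb := itv_partition_le (itv_partition_cons ps).
have := ps; rewrite /itv_partition/= => -[/andP[/ltW ay pys] lb].
have := hK a y (lexx _) ay yb.
have := IH y _ (itv_partition_cons ps).
move=> /(_ ltac:(move=> u t yu ut tb; apply: hK => //; exact: le_trans yu)).
by lra.
Qed.

Lemma arc_length_congr g h a b : (forall t, a <= t <= b -> g t = h t) ->
  arc_length g a b = arc_length h a b.
Proof.
suff key (f1 f2 : R -> E) : (forall t, a <= t <= b -> f1 t = f2 t) ->
    (arc_length f1 a b <= arc_length f2 a b)%E.
  by move=> e; apply/le_anti/andP; split; apply: key => t tab; rewrite e.
move=> e; apply: arc_length_le => s ps; apply: le_trans (chord_sum_le f2 ps).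
rewrite lee_fin; elim: s a e ps => [|y s IH] a e ps //=.
have yb := itv_partition_le (itv_partition_cons ps).
have := ps; rewrite /itv_partition/= => -[/andP[/ltW ay pys] lb].
rewrite !e ?ay ?yb ?lexx ?(le_trans ay yb)// lerD2l.
by apply: IH (itv_partition_cons ps) => t /andP[yt tb]; rewrite e// tb (le_trans ay).
Qed.

Lemma arc_length_opp g a b : a <= b ->
  arc_length (g \o -%R) (- b) (- a) = arc_length g a b.
Proof.
suff key (f : R -> E) x y : x <= y ->
    (arc_length (f \o -%R) (- y) (- x) <= arc_length f x y)%E.
  move=> ab; apply/le_anti; rewrite key//= -{1}[a]opprK -{1}[b]opprK.
  have e : g = (g \o -%R) \o -%R by apply/funext => t /=; rewrite opprK.
  by rewrite {1}e key// lerN2.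
move=> xy; apply: arc_length_le => s; rewrite -{3}[y]opprK.
elim: s (- y) {xy} => [|z s IH] u ps /=.
  by have -> := itv_partition_nil ps; rewrite opprK arc_length_xx.
have zx := itv_partition_le (itv_partition_cons ps).
have := ps; rewrite /itv_partition/= => -[/andP[/ltW uz pzs] lb].
have xz : x <= - z by rewrite lerNr.
have zu : - z <= - u by rewrite lerN2.
apply: le_trans (arc_length_superadd f xz zu).
rewrite EFinD addeC leeD//; first exact: IH (itv_partition_cons ps).
by rewrite distrC; exact: chord_le_arc_length.
Qed.

Lemma rectifiable_sub g a b u t : a <= u -> u <= t -> t <= b ->
  rectifiable g a b -> rectifiable g u t.
Proof.
move=> au ut tb; apply: le_lt_trans; apply: (@le_trans _ _ (arc_length g a t)).
  exact: arc_length_ler.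
by apply: arc_length_lel => //; exact: le_trans ut.
Qed.

(** An infinite length becomes 0, whence the rectifiability hypotheses below. *)
Definition len g a b := fine (arc_length g a b).

Lemma lenE g a b : a <= b -> rectifiable g a b -> arc_length g a b = (len g a b)%:E.
Proof.
by move=> ab gab; rewrite /len fineK// ge0_fin_numE ?arc_length_ge0.
Qed.

Lemma lenD g a m b : a <= m -> m <= b -> rectifiable g a b ->
  len g a b = len g a m + len g m b.
Proof.
move=> am mb gab; apply: EFin_inj; rewrite EFinD -!lenE ?(le_trans am)//.
- exact: arc_lengthD.
- exact: (rectifiable_sub am mb (lexx b) gab).
- exact: (rectifiable_sub (lexx a) am mb gab).
Qed.

Lemma len_ge0 g a b : a <= b -> 0 <= len g a b.
Proof. by move=> ab; rewrite /len fine_ge0// arc_length_ge0. Qed.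

Lemma len_xx g a : len g a a = 0.
Proof. by rewrite /len arc_length_xx. Qed.

Lemma chord_le_len g a b : a <= b -> rectifiable g a b -> `|g b - g a| <= len g a b.
Proof. by move=> ab gab; rewrite -lee_fin -lenE ?chord_le_arc_length. Qed.

End ArcLength.

(** * Boundary distance and curves *)

Section BoundaryDistance.
Context {R : realType} {E : completeNormedModType R}.
Implicit Types (D : set E) (g : R -> E) (a b t u e : R) (x y z w : E).

Lemma open_ball D x : open D -> D x ->
  exists2 e : R, 0 < e & forall y, `|x - y| < e -> D y.
Proof.
move=> oD Dx; have /nbhs_ballP[e /= e0 eD] := open_nbhs_nbhs (conj oD Dx).
by exists e => // y xy; apply: eD; rewrite -ball_normE.
Qed.

(** The infimum [t0] of the parameters outside [D] gives the boundary point: [f t0] is outside since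
    [D] is open, and the points just before it are inside. *)
Lemma segment_boundary D x y : open D -> D x -> ~ D y ->
  exists2 w, boundary D w & `|x - w| <= `|x - y|.
Proof.
move=> oD Dx nDy; pose f t := x + t *: (y - x).
have fdist s t : `|f s - f t| = `|s - t| * `|y - x|.
  by rewrite /f opprD addrACA subrr add0r -scalerBl normrZ.
pose T := [set t : R | 0 <= t <= 1 /\ ~ D (f t)].
have T1 : T 1 by split; rewrite ?ler01 ?lexx// /f scale1r addrC subrK.
have Tinf : has_inf T by split; [exists 1|exists 0 => t [/andP[]]].
pose t0 := inf T.
have t0_ge0 : 0 <= t0 by apply: lb_le_inf; [exists 1|move=> t [/andP[]]].
have t0_le1 : t0 <= 1 by apply: ge_inf => //; case: Tinf.
have small e : 0 < e -> exists2 h : R, 0 < h & h * `|y - x| < e.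
  move=> e0; exists (e / (`|y - x| + 1)); first by rewrite divr_gt0// ltr_wpDl.
  rewrite mulrAC ltr_pdivrMr ?ltr_wpDl// ltr_pM2l//; by rewrite ltrDl.
have nDw : ~ D (f t0).
  move=> /(open_ball oD)[e e0 eD]; have [h h0 he] := small _ e0.
  have [t [t01 nDt] tt0] := inf_adherent h0 Tinf.
  apply: (nDt); apply: eD; rewrite fdist distrC ger0_norm; last first.
    by rewrite subr_ge0; exact: (ge_inf (proj2 Tinf) (conj t01 nDt)).
  apply: le_lt_trans he; rewrite ler_wpM2r// lerBlDl ltW//.
have t0_gt0 : 0 < t0.
  rewrite lt_neqAle t0_ge0 andbT; apply/eqP => t00; apply: nDw.
  by rewrite -t00 /f scale0r addr0.
exists (f t0); last first.
  have -> : x = f 0 by rewrite /f scale0r addr0.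
  rewrite fdist sub0r normrN ger0_norm//.
  by rewrite [in leRHS]/f scale0r addr0 distrC ler_piMl.
split; last by move=> /interior_subset.
move=> B /nbhs_ballP[e /= e0 eB]; have [h h0 he] := small _ e0.
pose t := Num.max 0 (t0 - h).
have tt0 : t < t0 by rewrite /t gt_max t0_gt0 ltrBlDr ltrDl h0.
have t_ge0 : 0 <= t by rewrite /t le_max lexx.
exists (f t); split.
  apply: contrapT => nDt; have : T t by split=> //; rewrite t_ge0 (le_trans (ltW tt0)).
  move=> /(ge_inf (proj2 Tinf)); rewrite -/t0; by rewrite leNgt tt0.
apply: eB; rewrite -ball_normE /= fdist ger0_norm ?subr_ge0 ?ltW//.
apply: le_lt_trans he; rewrite ler_wpM2r//.
by rewrite lerBlDr -lerBlDl /t le_max lexx orbT.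
Qed.

(** This keeps [bdist] away from the default value of [inf] on the empty set. *)
Lemma boundary_nonempty D : D !=set0 -> D <> setT -> open D -> boundary D !=set0.
Proof.
move=> [x Dx] DT oD; have [y nDy] : exists y, ~ D y.
  apply: contrapT => /forallNP h; apply: DT; apply/seteqP; split => // y _.
  exact: (contrapT (h y)).
by have [w bw _] := segment_boundary oD Dx nDy; exists w.
Qed.

Lemma bdist_le D z w : boundary D w -> bdist D z <= `|z - w|.
Proof. by move=> bw; apply: ge_inf; [exists 0 => _ [v _ <-]|exists w]. Qed.

Lemma bdist_ge D z e : boundary D !=set0 ->
  (forall w, boundary D w -> e <= `|z - w|) -> e <= bdist D z.
Proof.
move=> [w bw] h; apply: lb_le_inf; first by exists `|z - w|; exists w.
by move=> _ [v bv <-]; exact: h.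
Qed.

Lemma bdist_lip D x y : boundary D !=set0 -> bdist D x <= bdist D y + `|x - y|.
Proof.
move=> bD; rewrite -lerBlDr; apply: bdist_ge => // w bw.
rewrite lerBlDr; apply: (le_trans (bdist_le x bw)).
by rewrite [leRHS]addrC; exact: ler_distD.
Qed.

Lemma bdist_gt0 D x : boundary D !=set0 -> open D -> D x -> 0 < bdist D x.
Proof.
move=> bD oD Dx; have [e e0 eD] := open_ball oD Dx.
apply: (lt_le_trans e0); apply: bdist_ge => // w [_ nw].
rewrite leNgt; apply/negP => xw; apply: nw.
have := open_nbhs_nbhs (conj oD (eD _ xw)); exact.
Qed.

Lemma bdist_ball D x y : open D -> D x -> `|x - y| < bdist D x -> D y.
Proof.
move=> oD Dx xy; apply: contrapT => nDy.
have [w bw xw] := segment_boundary oD Dx nDy.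
by have := bdist_le x bw; lra.
Qed.
End BoundaryDistance.

Section Curves.
Context {R : realType} {E : completeNormedModType R}.
Implicit Types (D : set E) (g : R -> E) (a b t u r e : R).

Definition eps_continuous g a b := forall t, a <= t <= b -> forall e, 0 < e ->
  exists2 h : R, 0 < h & forall u, a <= u <= b -> `|t - u| < h -> `|g t - g u| < e.

Lemma within_continuousP g a b :
  {within `[a, b], continuous g} <-> eps_continuous g a b.
Proof.
split.
  move=> cg t tab e e0; have abt : `[a, b]%classic t by rewrite /= in_itv.
  have /cvgrPdist_lt/(_ _ e0) := cg t.
  rewrite /prop_near1 /nbhs/= -nbhs_subspace_in//.
  move=> /nbhs_ballP[h /= h0 hh].
  exists h => // u uab tu; apply: hh; rewrite /= ?in_itv//.
move=> cg t; apply/cvgrPdist_lt => e e0.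
have [abt|nabt] := pselect (`[a, b]%classic t); last first.
  rewrite /prop_near1 /nbhs/= -nbhs_subspace_out// => u ->.
  by rewrite subrr normr0.
rewrite /prop_near1 /nbhs/= -nbhs_subspace_in//.
have [|h h0 hh] := cg t _ e e0; first by move: abt; rewrite /= in_itv.
apply/nbhs_ballP; exists h => //= u tu; rewrite in_itv/= => uab; exact: hh.
Qed.

(** Continuous induction along a curve, by steps that are short relative to the boundary distance.
    Near the supremum [m] of the good parameters, a single step leads from a good parameter to [m]
    or beyond. *)
Lemma curve_ind D g a b e (P : R -> Prop) : boundary D !=set0 -> open D ->
  curve_in D g a b -> 0 < e -> P a ->
  (forall u t, a <= u -> u < t -> t <= b -> P u ->
     (forall r, u <= r <= t -> `|g r - g u| <= e * bdist D (g u)) -> P t) -> P b.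
Proof.
move=> bD oD [ab /within_continuousP cg gD] e0 Pa Pstep.
pose T := [set t | a <= t <= b /\ P t].
have Ta : T a by split=> //; rewrite lexx.
have Tsup : has_sup T by split; [exists a|exists b => t [/andP[]]].
pose m := sup T.
have am : a <= m by apply: ub_le_sup => //; case: Tsup.
have mb : m <= b by apply: ge_sup; [exists a|move=> t [/andP[]]].
have Dm : D (g m) by apply: gD; exists m => //; rewrite /= in_itv/= am.
have d0 := bdist_gt0 bD oD Dm.
(* With 1/2, the boundary distance at [g u] is at least half of that at [g m]; with [e / 4], the
   oscillation [2 * e1 * bdist D (g m)] is then at most [e * bdist D (g u)]. *)
pose e1 := Num.min (1 / 2) (e / 4).
have e10 : 0 < e1 by rewrite lt_min; apply/andP; split; [|rewrite divr_gt0].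
have e1d : 0 < e1 * bdist D (g m) by rewrite mulr_gt0.
have [|h h0 hh] := cg m _ _ e1d; first by rewrite am.
have near u r : a <= u <= b -> a <= r <= b -> `|m - u| < h -> `|m - r| < h ->
    `|g r - g u| <= e * bdist D (g u).
  move=> uab rab mu mr; have h1 := hh u uab mu; have h2 := hh r rab mr.
  have h3 := bdist_lip (g m) (g u) bD; have h4 := ler_distD (g m) (g r) (g u).
  rewrite (distrC (g r) (g m)) in h4.
  have e12 : e1 <= 1 / 2 by rewrite /e1 ge_min lexx.
  have e1e : 4 * e1 <= e.
    by rewrite -ler_pdivlMl// mulrC ge_min lexx orbT.
  have h5 : e1 * bdist D (g m) <= bdist D (g m) / 2.
    by have := ler_wpM2r (ltW d0) e12; lra.
  have h6 : 2 * (e1 * bdist D (g m)) <= e * (bdist D (g m) / 2).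
    by have := ler_wpM2r (ltW d0) e1e; lra.
  have h7 : e * (bdist D (g m) / 2) <= e * bdist D (g u).
    by have h8 := ltW e0; rewrite ler_wpM2l//; lra.
  by lra.
have [u [uab Pu] mu] := sup_adherent h0 Tsup.
have um : u <= m by apply: ub_le_sup => //; case: Tsup.
have Tm t : T t -> t <= m by move=> Tt; apply: ub_le_sup => //; case: Tsup.
rewrite -/m in mu; clearbody m.
have key t : u < t -> t <= b -> `|m - t| < h -> P t.
  move=> ut tb mt; apply: (Pstep u t) => //; first by case/andP: uab.
  move=> r /andP[ur rt]; apply: near => //.
  - by rewrite (le_trans rt tb) andbT (le_trans _ ur)//; case/andP: uab.
  - by rewrite ger0_norm ?subr_ge0//; lra.
  - move: mt; rewrite !ltr_norml => /andP[? ?].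
    by apply/andP; split; lra.
have [mlb|bm] := ltP m b.
  pose t := Num.min b (m + h / 2).
  have tb : t <= b by rewrite /t ge_min lexx.
  have mt : m < t by rewrite /t lt_min mlb ltrDl divr_gt0.
  have : T t.
    split; first by rewrite tb andbT (le_trans am (ltW mt)).
    apply: key => //; first exact: le_lt_trans mt.
    rewrite distrC ger0_norm ?subr_ge0 ?ltW//.
    have tm : t <= m + h / 2 by rewrite /t ge_min lexx orbT.
    by lra.
  by move=> /Tm; lra.
have mb' : m = b by apply/le_anti; rewrite mb.
have [ub|bu] := ltP u b; first by apply: key => //; rewrite mb' subrr normr0.
by have <- : u = b by apply/le_anti; rewrite bu andbT; case/andP: uab.
Qed.
End Curves.

(** * Arc length parametrization and quasihyperbolic length *)

Lemma integral_cst_itv (R : realType) (l l' c : R) : 0 <= l' ->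
  (\int[lebesgue_measure]_(u in `]l, (l + l')%R]) cst c%:E u)%E = (l' * c)%:E.
Proof.
move=> l0; have ml : lebesgue_measure `]l, (l + l')%R]%classic = l'%:E.
  rewrite lebesgue_measure_itv/= lte_fin ltrDl.
  move: l0; rewrite le_eqVlt => /predU1P[<-|->]; first by rewrite ltxx.
  by rewrite -EFinB addrAC subrr add0r.
rewrite integral_cst//; transitivity (c%:E * l'%:E)%E; first by congr (_ * _)%E.
by rewrite -EFinM mulrC.
Qed.

Section ArcLengthParam.
Context {R : realType} {E : completeNormedModType R}.
Implicit Types (D : set E) (g : R -> E) (a b m t u v e : R).

(** The time at which [arclength_param] evaluates [g]. The length is below [u] before it and at
    least [u] after it ([ptime_lt], [ptime_gt]), which stands in for continuity of the arc
    length. *)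
Definition ptime g a b u :=
  inf [set t | t \in `[a, b] /\ (u%:E <= arc_length g a t)%E].

Let pset g a b u := [set t | t \in `[a, b] /\ (u%:E <= arc_length g a t)%E].

Let pset_inf g a b u : a <= b -> (u%:E <= arc_length g a b)%E -> has_inf (pset g a b u).
Proof.
move=> ab ub; split; first by exists b; split; rewrite // in_itv/= ab lexx.
by exists a => t []; rewrite in_itv/= => /andP[].
Qed.

Lemma ptime_bound g a b u : a <= b -> (u%:E <= arc_length g a b)%E ->
  a <= ptime g a b u <= b.
Proof.
move=> ab ub; have [T0 Tl] := pset_inf ab ub; apply/andP; split.
  by apply: lb_le_inf => // t []; rewrite in_itv/= => /andP[].
by apply: ge_inf => //; split; rewrite // in_itv/= ab lexx.
Qed.

Lemma ptime_lt g a b u t : a <= b -> (u%:E <= arc_length g a b)%E -> a <= t ->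
  t < ptime g a b u -> (arc_length g a t < u%:E)%E.
Proof.
move=> ab ub at_ tp; rewrite ltNge; apply/negP => ut.
have [_ pb] := andP (ptime_bound ab ub).
have : ptime g a b u <= t; last by rewrite leNgt tp.
apply: ge_inf; first by case: (pset_inf ab ub).
by split => //; rewrite in_itv/= at_ (le_trans (ltW tp)).
Qed.

Lemma ptime_gt g a b u t : a <= b -> (u%:E <= arc_length g a b)%E ->
  ptime g a b u < t -> (u%:E <= arc_length g a t)%E.
Proof.
move=> ab ub pt; have tp : 0 < t - ptime g a b u by rewrite subr_gt0.
have [s [sab us]] := inf_adherent tp (pset_inf ab ub).
rewrite -/(ptime g a b u) addrC subrK => st; apply: (le_trans us).
move: sab; rewrite in_itv/= => /andP[as_ _].
by apply: arc_length_lel => //; exact: ltW.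
Qed.

Lemma ptime_prefix g a m b u : a <= m -> m <= b -> (u%:E <= arc_length g a m)%E ->
  ptime g a m u = ptime g a b u.
Proof.
move=> am mb um.
have ub : (u%:E <= arc_length g a b)%E by apply: (le_trans um); exact: arc_length_lel.
have [T0 Tl] := pset_inf am um; have [S0 Sl] := pset_inf (le_trans am mb) ub.
apply/le_anti/andP; split.
  apply: lb_le_inf => // t [tab ut]; have [tm|mt] := leP t m.
    by apply: ge_inf => //; split => //; move: tab; rewrite !in_itv/= tm => /andP[->].
  apply: (le_trans _ (ltW mt)); apply: ge_inf => //; split => //.
  by rewrite in_itv/= am lexx.
apply: lb_le_inf => // t [tam ut]; apply: ge_inf => //; split => //.
by move: tam; rewrite !in_itv/= => /andP[-> tm]; exact: le_trans mb.
Qed.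

Lemma ptime_suffix g a m b u : a <= m -> m <= b ->
  (arc_length g a m < u%:E)%E -> (u%:E <= arc_length g a b)%E -> m <= ptime g a b u.
Proof.
move=> am mb mu ub; have [T0 Tl] := pset_inf (le_trans am mb) ub.
apply: lb_le_inf => // t [+ ut]; rewrite in_itv/= => /andP[at_ tb].
rewrite leNgt; apply/negP => tm.
have := le_lt_trans (arc_length_lel g at_ (ltW tm)) mu.
by rewrite ltNge ut.
Qed.

(** Slightly inside the interval between the two times, at [s] and [t], the length is at least [u]
    and less than [v], so the chord is at most [v - u]. Continuity of [g] alone then carries the
    bound to the ends. *)
Lemma arclength_param_lip g a b u v : a <= b -> eps_continuous g a b ->
  u <= v -> (v%:E <= arc_length g a b)%E ->
  `|arclength_param g a b u - arclength_param g a b v| <= v - u.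
Proof.
move=> ab cg uv vb; have ub : (u%:E <= arc_length g a b)%E.
  by apply: le_trans vb; rewrite lee_fin.
rewrite /arclength_param -/(ptime g a b u) -/(ptime g a b v).
have puv : ptime g a b u <= ptime g a b v.
  have [T0 Tl] := pset_inf ab ub; have [S0 Sl] := pset_inf ab vb.
  apply: lb_le_inf => // t [tab vt]; apply: ge_inf => //; split => //.
  by apply: le_trans vt; rewrite lee_fin.
have pu := ptime_bound ab ub; have pv := ptime_bound ab vb.
have gtu := ptime_gt ab ub; have ltv := ptime_lt ab vb.
move: puv pu pv gtu ltv; set p := ptime g a b u; set q := ptime g a b v.
rewrite le_eqVlt => /predU1P[-> *|pq pab qab gtu ltv].
  by rewrite subrr normr0 subr_ge0.
have [/andP[ap pb] /andP[aq qb]] := (pab, qab).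
apply/ler_addgt0Pr => e e0; have e2 : 0 < e / 2 by rewrite divr_gt0.
have [h h0 hh] := cg p pab _ e2; have [k k0 kk] := cg q qab _ e2.
pose s := Num.min (p + h / 2) ((p + q) / 2).
pose t := Num.max (q - k / 2) ((p + q) / 2).
have ps : p < s by rewrite /s lt_min; apply/andP; split; lra.
have tq : t < q by rewrite /t gt_max; apply/andP; split; lra.
have st : s <= t.
  by apply: (@le_trans _ _ ((p + q) / 2)); rewrite /s /t ?ge_min ?le_max lexx orbT.
have sh : s <= p + h / 2 by rewrite /s ge_min lexx.
have tk : q - k / 2 <= t by rewrite /t le_max lexx.
have hs : `|g p - g s| < e / 2.
  apply: hh; first by apply/andP; split; lra.
  by rewrite distrC ger0_norm; lra.
have ht : `|g q - g t| < e / 2.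
  apply: kk; first by apply/andP; split; lra.
  by rewrite ger0_norm; lra.
have as_ : a <= s by lra. 
have at_ : a <= t by lra.
have hst : `|g t - g s| <= v - u.
  have h1 := gtu s ps; have h2 := ltv t at_ tq.
  have h3 := arc_length_superadd g as_ st; have h4 := chord_le_arc_length g st.
  have := le_lt_trans (le_trans (leeD h1 h4) h3) h2.
  by rewrite -EFinD lte_fin; lra.
have := ler_distD (g s) (g p) (g q); have := ler_distD (g t) (g s) (g q).
rewrite (distrC (g s) (g t)) (distrC (g t) (g q)); lra.
Qed.

Definition pdom g a b := [set u : R | 0 <= u /\ (u%:E <= arc_length g a b)%E].

Lemma pdom_itv g a b : rectifiable g a b -> a <= b -> pdom g a b = `[0, len g a b]%classic.
Proof.
move=> rg ab; apply/seteqP; split => u; rewrite /pdom /= in_itv/= lenE// lee_fin.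
  by case=> -> ->.
by move/andP.
Qed.

Lemma measurable_pdom g a b : a <= b -> measurable (pdom g a b).
Proof.
move=> ab; have [lab|rg] := eqVneq (arc_length g a b) +oo%E.
  have -> : pdom g a b = `[0, +oo[%classic.
    by apply/seteqP; split => u; rewrite /pdom /= in_itv/= andbT lab leey // => -[].
  exact: measurable_itv.
by rewrite pdom_itv// /rectifiable ltey.
Qed.

Section Density.
Variables (D : set E) (g : R -> E) (a b : R).
Hypotheses (bD : boundary D !=set0) (oD : open D) (gD : curve_in D g a b).

Let ab : a <= b. Proof. by case: gD. Qed.
Let cg : eps_continuous g a b. Proof. by apply/within_continuousP; case: gD. Qed.
Let gt_in t : a <= t <= b -> D (g t).
Proof. by move=> tab; case: gD => _ _; apply; exists t => //=; rewrite in_itv. Qed.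

Let f u := (bdist D (arclength_param g a b u))^-1.

Let param_in u : pdom g a b u -> D (arclength_param g a b u).
Proof. by move=> [_ ub]; apply: gt_in; exact: ptime_bound. Qed.

Let f_gt0 u : pdom g a b u -> 0 < f u.
Proof. by move=> /param_in Du; rewrite invr_gt0; exact: bdist_gt0. Qed.

Let param_dist u v : pdom g a b u -> pdom g a b v ->
  `|arclength_param g a b u - arclength_param g a b v| <= `|u - v|.
Proof.
have [uv _ [_ ?]|vu [_ ?] _] := leP u v.
  by rewrite (distrC u v) ger0_norm ?subr_ge0//; exact: arclength_param_lip.
rewrite (distrC (arclength_param g a b u)) ger0_norm; last by rewrite subr_ge0 ltW.
by apply: arclength_param_lip => //; exact: ltW.
Qed.

Lemma measurable_density : measurable_fun (pdom g a b) (fun u => (f u)%:E).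
Proof.
apply/measurable_EFinP; apply: subspace_continuous_measurable_fun.
  exact: measurable_pdom.
apply/subspace_continuousP => u Iu; apply: cvgV.
  by rewrite gt_eqF//; apply: bdist_gt0 => //; exact: param_in.
apply/cvgrPdist_lt => e e0; rewrite near_withinE; apply/nbhs_ballP.
exists e => //= v; rewrite -ball_normE /= => uv Iv.
apply: le_lt_trans uv; apply: le_trans (param_dist Iu Iv).
have := bdist_lip (arclength_param g a b u) (arclength_param g a b v) bD.
have := bdist_lip (arclength_param g a b v) (arclength_param g a b u) bD.
by rewrite distrC ler_norml => h1 h2; apply/andP; split; lra.
Qed.

(** Infinite arc length is allowed, so that a finite quasihyperbolic length implies
    rectifiability. *)
Lemma qh_length_ge M : 0 < M -> (forall t, a <= t <= b -> bdist D (g t) <= M) ->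
  (M^-1%:E * arc_length g a b <= qh_length D g a b)%E.
Proof.
move=> M0 dM.
have -> : arc_length g a b = lebesgue_measure (pdom g a b).
  have [lab|rg] := eqVneq (arc_length g a b) +oo%E.
    have -> : pdom g a b = `[0, +oo[%classic.
      by apply/seteqP; split => u; rewrite /pdom /= in_itv/= andbT lab leey // => -[].
    by rewrite lebesgue_measure_itv/= ltry.
  have r : rectifiable g a b by rewrite /rectifiable ltey.
  rewrite pdom_itv// lebesgue_measure_itv/= lte_fin -EFinB subr0 lenE//.
  by have := len_ge0 g ab; rewrite le_eqVlt => /predU1P[<-|->//]; rewrite ltxx.
have mI := measurable_pdom g ab; rewrite -integral_cst//.
apply: ge0_le_integral => //.
- by move=> u _; rewrite lee_fin invr_ge0 ltW.
- exact: measurable_density.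
- move=> u Iu; rewrite lee_fin lef_pV2 ?posrE//; first by apply: dM; exact: ptime_bound Iu.2.
  by have := f_gt0 Iu; rewrite invr_gt0.
Qed.

Hypothesis rg : rectifiable g a b.

Lemma qh_lengthE : qh_length D g a b = (\int[lebesgue_measure]_(u in `[0%R, len g a b]) (f u)%:E)%E.
Proof. by rewrite /qh_length -pdom_itv. Qed.

Lemma qh_length_prefix m : a <= m -> m <= b -> qh_length D g a m =
  (\int[lebesgue_measure]_(u in `[0%R, len g a m]) (f u)%:E)%E.
Proof.
move=> am mb; have rm := rectifiable_sub (lexx a) am mb rg.
rewrite -(pdom_itv rm am); apply: eq_integral => u; rewrite inE => -[u0 ul].
congr (_ %:E); rewrite /f /arclength_param.
by rewrite -/(ptime g a b u) -/(ptime g a m u) (ptime_prefix am mb).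
Qed.

(** The tail stays in the parametrization starting at [a]; [qh_length_add_ge] and [qh_length_add_le]
    bound its density, whose values are reciprocals of [bdist] at points of [g] on [[m, b]]. *)
Lemma qh_length_split m : a <= m -> m <= b -> qh_length D g a b =
  (qh_length D g a m +
   \int[lebesgue_measure]_(u in `]len g a m, (len g a m + len g m b)%R]) (f u)%:E)%E.
Proof.
move=> am mb; rewrite qh_lengthE qh_length_prefix// (lenD am mb rg).
have l1 := len_ge0 g am; have l2 := len_ge0 g mb.
have U : `[0, len g a m + len g m b]%classic =
    `[0, len g a m] `|` `]len g a m, len g a m + len g m b].
  apply/seteqP; split => u /=; rewrite !in_itv/=.
    by move=> /andP[u0 ul]; have [?|?] := leP u (len g a m); [left; rewrite u0|right].
  by case=> /andP[h1 h2]; apply/andP; split; lra.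
rewrite U ge0_integral_setU//.
- rewrite -U -lenD// -pdom_itv//; exact: measurable_density.
- move=> u; rewrite -U -lenD// -pdom_itv// => Iu.
  by rewrite lee_fin ltW// f_gt0.
- apply/disj_setPS => u /= []; rewrite !in_itv/= => /andP[_ h1] /andP[h2 _].
  lra.
Qed.

(** The lower bound is strict because the length [len g a m] may already be reached before [m], when
    [g] is constant just before [m]. *)
Let suffix_param m u : a <= m -> m <= b -> len g a m < u <= len g a m + len g m b ->
  pdom g a b u /\ exists2 t, m <= t <= b & f u = (bdist D (g t))^-1.
Proof.
move=> am mb /andP[h1 h2]; have l1 := len_ge0 g am.
have ub : (u%:E <= arc_length g a b)%E by rewrite lenE// (lenD am mb rg) lee_fin.
split; first by split=> //; lra.
exists (ptime g a b u); last by [].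
rewrite (ptime_suffix am mb)//; first by case/andP: (ptime_bound ab ub).
by rewrite lenE// ?lte_fin//; exact: (rectifiable_sub (lexx a) am mb rg).
Qed.

Let measurable_suffix m : a <= m -> m <= b ->
  measurable_fun `]len g a m, (len g a m + len g m b)%R] (fun u => (f u)%:E).
Proof.
move=> am mb; apply: measurable_funS measurable_density.
  exact: measurable_pdom.
move=> u /=; rewrite in_itv/= => /(suffix_param am mb)[]; exact.
Qed.

Lemma qh_length_add_ge m M : a <= m -> m <= b -> 0 < M ->
  (forall t, m <= t <= b -> bdist D (g t) <= M) ->
  (qh_length D g a m + (len g m b / M)%:E <= qh_length D g a b)%E.
Proof.
move=> am mb M0 dM; rewrite (qh_length_split am mb) leeD2l//.
have l2 := len_ge0 g mb; set l := len g a m; set l' := len g m b.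
have -> : (l' / M)%:E =
    (\int[lebesgue_measure]_(u in `]l, (l + l')%R]) cst (M^-1)%:E u)%E.
  by rewrite integral_cst_itv.
apply: ge0_le_integral => //.
- by move=> u _; rewrite lee_fin invr_ge0 ltW.
- exact: measurable_suffix.
- move=> u /=; rewrite in_itv/= => /(suffix_param am mb)[/f_gt0 + [t tmb ft]].
  rewrite ft invr_gt0 => dt; rewrite lee_fin lef_pV2 ?posrE//; exact: dM.
Qed.

Lemma qh_length_add_le m e : a <= m -> m <= b -> 0 < e ->
  (forall t, m <= t <= b -> e <= bdist D (g t)) ->
  (qh_length D g a b <= qh_length D g a m + (len g m b / e)%:E)%E.
Proof.
move=> am mb e0 de; rewrite (qh_length_split am mb) leeD2l//.
have l2 := len_ge0 g mb; set l := len g a m; set l' := len g m b.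
have -> : (l' / e)%:E =
    (\int[lebesgue_measure]_(u in `]l, (l + l')%R]) cst (e^-1)%:E u)%E.
  by rewrite integral_cst_itv.
apply: ge0_le_integral => //.
- by move=> u /=; rewrite in_itv/= => /(suffix_param am mb)[/f_gt0/ltW + _]; rewrite lee_fin.
- exact: measurable_suffix.
- move=> u /=; rewrite in_itv/= => /(suffix_param am mb)[/f_gt0 + [t tmb ft]].
  rewrite ft invr_gt0 => dt; rewrite lee_fin lef_pV2 ?posrE//; exact: de.
Qed.

End Density.

Lemma qh_length_ge0 D g a b : (0 <= qh_length D g a b)%E.
Proof.
apply: integral_ge0 => u _; rewrite lee_fin invr_ge0.
rewrite /bdist; set T := [set _ | _ in _].
have [->|/set0P h] := eqVneq T set0; first by rewrite inf0.
by apply: lb_le_inf => // _ [w _ <-].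
Qed.

Lemma qh_length_xx D g a : qh_length D g a a = 0%E.
Proof.
rewrite /qh_length arc_length_xx.
have -> : [set u : R | 0 <= u /\ (u%:E <= 0)%E] = [set 0].
  apply/seteqP; split => u /=; last by move=> ->.
  by rewrite lee_fin => -[h1 h2]; apply/le_anti; rewrite h1 h2.
exact: integral_set1.
Qed.

End ArcLengthParam.

(** * Appending a segment to an injective arc *)

Section Gluing.
Context {R : realType} {E : completeNormedModType R}.
Implicit Types (D : set E) (g h : R -> E) (a b m t u e : R) (p q x y : E).

Lemma eps_continuous_sub g a b u t : a <= u -> t <= b ->
  eps_continuous g a b -> eps_continuous g u t.
Proof.
move=> au tb cg s /andP[us st] e e0.
have [|h h0 hh] := cg s _ e e0; first by rewrite (le_trans au us) (le_trans st).
by exists h => // r /andP[ur rt]; apply: hh; rewrite (le_trans au ur) (le_trans rt).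
Qed.

Lemma eps_continuous_congr g h a b : (forall t, a <= t <= b -> g t = h t) ->
  eps_continuous g a b -> eps_continuous h a b.
Proof.
move=> gh cg t tab e e0; have [k k0 kk] := cg t tab e e0.
by exists k => // u uab tu; rewrite -!gh//; exact: kk.
Qed.

Lemma eps_continuous_glue g a m b : a <= m -> m <= b ->
  eps_continuous g a m -> eps_continuous g m b -> eps_continuous g a b.
Proof.
move=> am mb /within_continuousP cl /within_continuousP cr.
apply/within_continuousP.
have -> : `[a, b]%classic = `[a, m] `|` `[m, b].
  apply/seteqP; split => u /=; rewrite !in_itv/=.
    by move=> /andP[? ?]; have [?|/ltW ?] := leP u m; [left|right]; apply/andP.
  by case=> /andP[? ?]; apply/andP; split => //; [exact: le_trans mb|exact: le_trans am _].
by apply: withinU_continuous => //; exact: interval_closed.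
Qed.

Lemma eps_continuous_lip g a b (K : R) :
  (forall t u, `|g t - g u| <= K * `|t - u|) -> eps_continuous g a b.
Proof.
move=> hK t _ e e0; exists (e / (`|K| + 1)); first by rewrite divr_gt0// ltr_wpDl.
move=> u _; rewrite ltr_pdivlMr ?ltr_wpDl// => tu; apply: le_lt_trans tu.
apply: (le_trans (hK t u)); rewrite mulrC ler_wpM2l//.
by rewrite (le_trans (ler_norm K))// lerDl.
Qed.

Lemma curve_in_sub D g a b u t : a <= u -> u <= t -> t <= b ->
  curve_in D g a b -> curve_in D g u t.
Proof.
move=> au ut tb [ab /within_continuousP cg gD]; split => //.
  by apply/within_continuousP; exact: eps_continuous_sub cg.
move=> _ [s + <-]; rewrite /= in_itv/= => /andP[us st]; apply: gD; exists s => //=.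
by rewrite in_itv/= (le_trans au us) (le_trans st).
Qed.

Lemma curve_inP D g a b t : curve_in D g a b -> a <= t <= b -> D (g t).
Proof. by move=> [_ _ gD] tab; apply: gD; exists t => //=; rewrite in_itv. Qed.

Lemma qh_length_congr D g h a b : a <= b -> (forall t, a <= t <= b -> g t = h t) ->
  qh_length D g a b = qh_length D h a b.
Proof.
move=> ab gh; rewrite /qh_length (arc_length_congr gh).
apply: eq_integral => u; rewrite inE => -[u0 ub].
congr ((bdist D _)^-1%:E); rewrite /arclength_param.
have -> : [set t | t \in `[a, b] /\ (u%:E <= arc_length h a t)%E] =
          [set t | t \in `[a, b] /\ (u%:E <= arc_length g a t)%E].
  apply/seteqP; split => t /= [+ ut]; rewrite in_itv/= => /andP[a_t tb]; split => //;
    rewrite ?in_itv/= ?a_t//; [rewrite (@arc_length_congr _ _ g h)//|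
      rewrite -(@arc_length_congr _ _ g h)//] => s /andP[as_ st];
    by rewrite gh// as_ (le_trans st).
by apply: (gh); apply: ptime_bound => //; rewrite (arc_length_congr gh).
Qed.

Lemma qh_length_prefix_le D g a m b : boundary D !=set0 -> open D ->
  curve_in D g a b -> rectifiable g a b -> a <= m -> m <= b ->
  (qh_length D g a m <= qh_length D g a b)%E.
Proof.
move=> bD oD cg rg am mb; rewrite (qh_length_split bD oD cg rg am mb) leeDl//.
apply: integral_ge0 => u _; rewrite lee_fin invr_ge0.
by apply: bdist_ge => // w _.
Qed.

Definition arc_to D x y (l : R) := exists g a b,
  [/\ arc_in D g a b, rectifiable g a b, g a = x, g b = y &
      (qh_length D g a b <= l%:E)%E].

Lemma arc_to_const D x : D x -> arc_to D x x 0.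
Proof.
move=> Dx; exists (fun=> x), 0, 0; split=> //.
- split.
    split=> //; last by move=> _ [t _ <-].
    by apply/within_continuousP; apply: (@eps_continuous_lip _ _ _ 0) => t u;
      rewrite subrr normr0 mul0r.
  move=> s t; rewrite !in_itv/= => /andP[s0 s1] /andP[t0 t1] _.
  by apply/le_anti; rewrite (le_trans s1)// (le_trans t1).
- by rewrite /rectifiable arc_length_xx.
- by rewrite qh_length_xx.
Qed.

(** The image of the curve is compact, so the segment from [p] to [q] has a last point on it. *)
Lemma last_exit g a b p q : a <= b -> eps_continuous g a b -> g b = p ->
  exists s t : R, [/\ a <= s <= b, 0 <= t <= 1, g s = p + t *: (q - p) &
    forall s' t', a <= s' <= b -> t < t' <= 1 -> g s' <> p + t' *: (q - p)].
Proof.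
move=> ab cg gb; pose f t := p + t *: (q - p).
pose K := g @` `[a, b].
have clK : closed K.
  apply: compact_closed; first exact: norm_hausdorff.
  apply: continuous_compact; last exact: segment_compact.
  exact/within_continuousP.
pose T := [set t : R | 0 <= t <= 1 /\ K (f t)].
have T0 : T 0.
  split; first by rewrite lexx ler01.
  by exists b; rewrite /= ?in_itv/= ?ab ?lexx// /f scale0r addr0.
have Tsup : has_sup T by split; [exists 0|exists 1 => t [/andP[]]].
pose t := sup T.
have t0 : 0 <= t by apply: ub_le_sup => //; case: Tsup.
have t1 : t <= 1 by apply: ge_sup; [exists 0|move=> s [/andP[]]].
have Kt : K (f t).
  rewrite ((closure_id K).1 clK) => B /nbhs_ballP[e /= e0 eB].
  have e1 : 0 < e / (`|q - p| + 1) by rewrite divr_gt0// ltr_wpDl.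
  have [s [s01 Ks] ts] := sup_adherent e1 Tsup.
  have st : s <= t by apply: ub_le_sup; [case: Tsup|split].
  exists (f s); split => //; apply: eB; rewrite -ball_normE /= /f.
  rewrite opprD addrACA subrr add0r -scalerBl normrZ ger0_norm ?subr_ge0//.
  rewrite -/t ltrBlDl -ltrBlDr in ts.
  apply: (@le_lt_trans _ _ ((t - s) * (`|q - p| + 1))).
    by rewrite ler_wpM2l ?subr_ge0// lerDl.
  by rewrite -ltr_pdivlMr ?ltr_wpDl//; lra.
have [s + gs] := Kt; rewrite /= in_itv/= => sab.
exists s, t; split => //; first by rewrite t0.
move=> s' t' sab' /andP[tt' t'1] gs'.
have : T t'.
  by split; [rewrite t'1 (le_trans t0 (ltW tt'))|exists s'; rewrite //= in_itv].
by move=> /(ub_le_sup (proj2 Tsup)); rewrite leNgt tt'.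
Qed.

(** The arc is cut where the segment meets it last and continued along the rest of the segment,
    which keeps it injective. Both parts are at most as long as the originals, so the bounds add
    up. *)
Lemma arc_to_append D x p q l e : boundary D !=set0 -> open D ->
  arc_to D x p l -> 0 < e ->
  (forall s, 0 <= s <= 1 -> D (p + s *: (q - p)) /\ e <= bdist D (p + s *: (q - p))) ->
  arc_to D x q (l + `|p - q| / e).
Proof.
move=> bD oD [g [a [b [[cg injg] rg ga gb lg]]]] e0 seg.
have [epq|npq] := eqVneq p q.
  by exists g, a, b; split=> //; rewrite -?epq// subrr normr0 mul0r addr0.
have ab : a <= b by case: cg.
have ecg : eps_continuous g a b by apply/within_continuousP; case: cg.
have [s [t [/andP[as_ sb] /andP[t0 t1] gs hT]]] := last_exit q ab ecg gb.
pose f r := p + (r - s + t) *: (q - p).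
pose h r := if r <= s then g r else f r.
pose c := s + (1 - t).
have sc : s <= c by rewrite /c; lra.
have hg r : a <= r <= s -> g r = h r by rewrite /h => /andP[_ ->].
have hf r : s <= r <= c -> f r = h r.
  rewrite /h => /andP[sr _]; case: leP => // rs.
  by have -> : r = s by [apply/le_anti; rewrite rs]; rewrite gs /f subrr add0r.
have fdist r r' : `|f r - f r'| = `|r - r'| * `|q - p|.
  rewrite /f opprD addrACA subrr add0r -scalerBl normrZ; congr (`|_| * _); lra.
have ac : a <= c by exact: le_trans sc.
have ch : curve_in D h a c.
  split=> //.
    apply/within_continuousP; apply: (eps_continuous_glue as_ sc).
      by apply: eps_continuous_congr hg _; exact: eps_continuous_sub ecg.
    apply: eps_continuous_congr hf _; apply: (@eps_continuous_lip _ _ _ `|q - p|).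
    by move=> r r'; rewrite fdist mulrC.
  move=> _ [r + <-]; rewrite /= in_itv/= => /andP[ar rc]; rewrite /h; case: leP => rs.
    by apply: (curve_inP cg); rewrite ar (le_trans rs).
  by apply: (seg _ _).1; apply/andP; split; rewrite /c in rc; lra.
have lf : (arc_length h s c <= (`|p - q|)%:E)%E.
  rewrite -(arc_length_congr hf); apply: (@le_trans _ _ (`|q - p| * (c - s))%:E).
    apply: arc_length_lip => // r r' _ rr' _; rewrite fdist mulrC ger0_norm//.
    by rewrite subr_ge0.
  by rewrite lee_fin distrC ler_piMr// /c; lra.
have rh : rectifiable h a c.
  rewrite /rectifiable (arc_lengthD h as_ sc) -(arc_length_congr hg).
  apply: lte_add_pinfty.
    exact: (rectifiable_sub (lexx a) as_ sb rg).
  exact: le_lt_trans lf (ltry _).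
exists h, a, c; split => //.
- split=> // r r'; rewrite !in_itv/= => /andP[ar rc] /andP[ar' rc'].
  rewrite /h; case: leP => rs; case: leP => rs'.
  + by apply: injg; rewrite in_itv/= ?ar ?ar' /= ?(le_trans rs sb) ?(le_trans rs' sb).
  + move=> gf; exfalso; apply: (hT r (r' - s + t)) gf.
      by rewrite ar (le_trans rs).
    by apply/andP; split; rewrite /c in rc'; lra.
  + move=> /esym gf; exfalso; apply: (hT r' (r - s + t)) gf.
      by rewrite ar' (le_trans rs').
    by apply/andP; split; rewrite /c in rc; lra.
  + move=> ff; have : `|f r - f r'| == 0 by rewrite ff subrr normr0.
    rewrite fdist mulf_eq0 !normr_eq0 !subr_eq0 => /orP[/eqP//|/eqP qp].
    by rewrite qp eqxx in npq.
- by rewrite -hg ?lexx.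
- rewrite -hf ?sc ?lexx// /f; have -> : c - s + t = 1 by rewrite /c; lra.
  by rewrite scale1r addrC subrK.
have sege r : s <= r <= c -> e <= bdist D (h r).
  move=> src; rewrite -hf//; apply: (seg _ _).2.
  by move: src; rewrite /c => /andP[? ?]; apply/andP; split; lra.
apply: le_trans (qh_length_add_le bD oD ch rh as_ sc e0 sege) _.
rewrite EFinD; apply: leeD.
  rewrite -(qh_length_congr D as_ hg); apply: le_trans lg.
  exact: qh_length_prefix_le.
rewrite lee_fin ler_pM2r ?invr_gt0// -lee_fin -lenE//.
exact: (rectifiable_sub as_ sc (lexx c) rh).
Qed.

End Gluing.

(** * The quasihyperbolic distance *)

Section QhDist.
Context {R : realType} {E : completeNormedModType R} (D : set E).
Implicit Types (g : R -> E) (a b m t u e l th : R) (p q x y z : E).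

Hypotheses (bD : boundary D !=set0) (oD : open D).
Hypothesis D_joined : forall x y, D x -> D y ->
  exists g a b, [/\ curve_in D g a b, rectifiable g a b, g a = x & g b = y].

Let kset x y := [set l | exists g a b,
    [/\ arc_in D g a b, rectifiable g a b, g a = x, g b = y
      & l = qh_length D g a b]].

Let kset_ge0 x y : (0 <= ereal_inf (kset x y))%E.
Proof.
by apply: le_ereal_inf_tmp => _ [g [a [b [_ _ _ _ ->]]]]; exact: qh_length_ge0.
Qed.

Lemma qh_dist_ge0 x y : 0 <= qh_dist D x y.
Proof. by rewrite /qh_dist fine_ge0// kset_ge0. Qed.

Lemma qh_dist_le x y l : arc_to D x y l -> qh_dist D x y <= l.
Proof.
move=> [g [a [b [arcg rg ga gb lg]]]].
have kl : (ereal_inf (kset x y) <= l%:E)%E.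
  by apply: ereal_inf_le; exists (qh_length D g a b) => //; exists g, a, b.
rewrite -lee_fin /qh_dist fineK// ge0_fin_numE; last exact: kset_ge0.
exact: le_lt_trans kl (ltry _).
Qed.

Let kset_fin x y l : arc_to D x y l -> ereal_inf (kset x y) \is a fin_num.
Proof.
move=> [g [a [b [arcg rg ga gb lg]]]]; rewrite ge0_fin_numE; last exact: kset_ge0.
apply: le_lt_trans (le_lt_trans lg (ltry _)).
by apply: ereal_inf_le; exists (qh_length D g a b) => //; exists g, a, b.
Qed.

Lemma arc_to_qh_dist x y l e : arc_to D x y l -> 0 < e ->
  arc_to D x y (qh_dist D x y + e).
Proof.
move=> /kset_fin kfin e0; have [_ [g [a [b [arcg rg ga gb ->]]]] lg] :=
  lb_ereal_inf_adherent e0 kfin.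
exists g, a, b; split=> //; rewrite EFinD /qh_dist fineK//; exact: ltW.
Qed.

Lemma qh_dist_ge x y l r : arc_to D x y l ->
  (forall g a b, curve_in D g a b -> rectifiable g a b -> g a = x -> g b = y ->
    (r%:E <= qh_length D g a b)%E) -> r <= qh_dist D x y.
Proof.
move=> /kset_fin kfin h; rewrite -lee_fin /qh_dist fineK//.
by apply: le_ereal_inf_tmp => _ [g [a [b [[cg _] rg ga gb ->]]]]; exact: h.
Qed.

Lemma ball_bdist p q th : D p -> 0 <= th < 1 -> `|p - q| <= th * bdist D p ->
  (forall s, 0 <= s <= 1 -> D (p + s *: (q - p)) /\
    (1 - th) * bdist D p <= bdist D (p + s *: (q - p))).
Proof.
move=> Dp /andP[th0 th1] pq s /andP[s0 s1]; have d0 := bdist_gt0 bD oD Dp.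
have ps : `|p - (p + s *: (q - p))| <= th * bdist D p.
  rewrite opprD addNKr normrN normrZ ger0_norm// distrC.
  by apply: le_trans pq; rewrite ler_piMl.
split.
  apply: (bdist_ball oD Dp); apply: (le_lt_trans ps).
  by rewrite -[ltRHS]mul1r ltr_pM2r.
have := bdist_lip p (p + s *: (q - p)) bD; lra.
Qed.

Lemma ball_in p q th : D p -> 0 <= th < 1 -> `|p - q| <= th * bdist D p -> D q.
Proof.
move=> Dp th01 pq; have [|+ _] := ball_bdist Dp th01 pq (s := 1).
  by rewrite ler01 lexx.
by rewrite scale1r addrC subrK.
Qed.

Lemma arc_to_ball x p q l th : arc_to D x p l -> D p -> 0 <= th < 1 ->
  `|p - q| <= th * bdist D p -> arc_to D x q (l + `|p - q| / ((1 - th) * bdist D p)).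
Proof.
move=> xp Dp th01 pq; apply: arc_to_append => //; last exact: ball_bdist.
by rewrite mulr_gt0 ?bdist_gt0// subr_gt0; case/andP: th01.
Qed.

Lemma arc_to_ex x y : D x -> D y -> exists l, arc_to D x y l.
Proof.
move=> Dx Dy; have [g [a [b [cg rg ga gb]]]] := D_joined Dx Dy.
have h0 : 0 < 1 / 2 :> R by [].
rewrite -gb; apply: (curve_ind (P := fun t => exists l, arc_to D x (g t) l) bD oD cg h0).
  by rewrite ga; exists 0; exact: arc_to_const.
move=> u t au ut tb [l xu] near; eexists.
have Du : D (g u) by apply: (curve_inP cg); rewrite au (le_trans (ltW ut)).
apply: (arc_to_ball xu Du (th := 1 / 2)).
  by apply/andP; split; lra.
by rewrite distrC; apply: near; rewrite (ltW ut) lexx.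
Qed.

Lemma qh_dist_append x p q th : D x -> D p -> 0 <= th < 1 ->
  `|p - q| <= th * bdist D p ->
  qh_dist D x q <= qh_dist D x p + `|p - q| / ((1 - th) * bdist D p).
Proof.
move=> Dx Dp th01 pq; have [l xp] := arc_to_ex Dx Dp.
apply/ler_addgt0Pr => e e0; rewrite addrAC; apply: qh_dist_le.
by apply: arc_to_ball => //; exact: (arc_to_qh_dist xp e0).
Qed.

Lemma qh_dist_xx x : D x -> qh_dist D x x = 0.
Proof.
by move=> Dx; apply/le_anti; rewrite qh_dist_ge0 andbT; apply/qh_dist_le/arc_to_const.
Qed.

Lemma qh_dist_ball p q th : D p -> 0 <= th < 1 -> `|p - q| <= th * bdist D p ->
  qh_dist D p q <= `|p - q| / ((1 - th) * bdist D p).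
Proof. by move=> Dp th01 pq; have := qh_dist_append Dp Dp th01 pq; rewrite qh_dist_xx// add0r. Qed.

(** Obtained by appending the reversed segment to the constant arc at [q], because the symmetry of
    [qh_dist] is deduced from this bound. *)
Lemma qh_dist_ballC p q th : D p -> 0 <= th < 1 -> `|p - q| <= th * bdist D p ->
  qh_dist D q p <= `|p - q| / ((1 - th) * bdist D p).
Proof.
move=> Dp th01 pq; rewrite -[leRHS]add0r distrC; apply: qh_dist_le.
apply: arc_to_append => //.
- exact/arc_to_const/(ball_in Dp th01 pq).
- by rewrite mulr_gt0 ?bdist_gt0// subr_gt0; case/andP: th01.
move=> s /andP[s0 s1]; have -> : q + s *: (p - q) = p + (1 - s) *: (q - p).
  by rewrite scalerBl scale1r addrA [p + (q - p)]addrC subrK -scalerN opprB.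
by apply: ball_bdist => //; apply/andP; split; lra.
Qed.

(** On a step within [th * bdist D (g u)] of [g u], the density is at least the inverse of
    [(1 + th) * bdist D (g u)], while [f] grows at most at the rate inverse to
    [(1 - th) * bdist D (g u)]. *)
Lemma local_lip_curve (f : E -> R) g a b th : 0 < th < 1 ->
  (forall p q, D p -> D q -> `|p - q| <= th * bdist D p ->
    f q - f p <= `|p - q| / ((1 - th) * bdist D p)) ->
  curve_in D g a b -> rectifiable g a b ->
  (((1 - th) / (1 + th) * (f (g b) - f (g a)))%:E <= qh_length D g a b)%E.
Proof.
move=> /andP[th0 th1] hf cg rg.
apply: (curve_ind (P := fun t => (((1 - th) / (1 + th) * (f (g t) - f (g a)))%:E <=
   qh_length D g a t)%E) bD oD cg th0).
  by rewrite subrr mulr0 qh_length_xx.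
move=> u t au ut tb IH near; have uab : a <= u <= b by rewrite au (le_trans (ltW ut)).
have tab : a <= t <= b by rewrite (le_trans au (ltW ut)).
have Du := curve_inP cg uab; have Dt := curve_inP cg tab.
have d0 := bdist_gt0 bD oD Du; have ut' := ltW ut.
have at_ : a <= t by case/andP: tab.
have ct := curve_in_sub (lexx a) at_ tb cg; have rt := rectifiable_sub (lexx a) at_ tb rg.
have M0 : 0 < (1 + th) * bdist D (g u) by rewrite mulr_gt0//; lra.
have dM r : u <= r <= t -> bdist D (g r) <= (1 + th) * bdist D (g u).
  by move=> /near; have := bdist_lip (g r) (g u) bD; lra.
apply: le_trans (qh_length_add_ge bD oD ct rt au ut' M0 dM).
apply: le_trans (leeD2r _ IH); rewrite -EFinD lee_fin.
have -> : f (g t) - f (g a) = (f (g u) - f (g a)) + (f (g t) - f (g u)) by lra.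
rewrite mulrDr lerD2l.
have ru := rectifiable_sub au ut' tb rg.
have pq : `|g u - g t| <= th * bdist D (g u) by rewrite distrC; apply: near; rewrite ut' lexx.
have := hf _ _ Du Dt pq; rewrite distrC => h1.
have h2 := chord_le_len ut' ru.
have t1 : 0 < (1 - th) / (1 + th) by rewrite divr_gt0; lra.
apply: (@le_trans _ _ (`|g t - g u| / ((1 + th) * bdist D (g u)))).
  apply: (le_trans (ler_wpM2l (ltW t1) h1)); rewrite le_eqVlt; apply/orP; left.
  apply/eqP; field; rewrite !gt_eqF//=; lra.
by rewrite ler_pM2r ?invr_gt0.
Qed.

(** The case [th] -> 0. Applied to [qh_dist D x], to the distance to a fixed point and to the
    logarithm of [bdist], it yields the triangle inequality, the symmetry and [ln_bdist_lip]. *)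
Lemma local_lip_qh_dist (f : E -> R) x y :
  (forall th p q, 0 < th < 1 -> D p -> D q -> `|p - q| <= th * bdist D p ->
    f q - f p <= `|p - q| / ((1 - th) * bdist D p)) ->
  D x -> D y -> f y - f x <= qh_dist D x y.
Proof.
move=> hf Dx Dy; have [l xy] := arc_to_ex Dx Dy.
apply: (qh_dist_ge xy) => g a b cg rg <- <-.
have [fle|fgt] := leP (f (g b) - f (g a)) 0.
  by apply: le_trans (qh_length_ge0 _ _ _ _); rewrite lee_fin.
have := qh_length_ge0 D g a b.
have key th th01 := local_lip_curve th01 (fun p q => hf th p q th01) cg rg.
move: key; case: (qh_length D g a b) => [L| |]// key L0; last by rewrite leey.
rewrite lee_fin leNgt; apply/negP => Lf; rewrite lee_fin in L0.
move: (f (g b) - f (g a)) fgt Lf key => F F0 LF key.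
(* The bound [(1 - th) * F <= (1 + th) * L] means [F - L <= th * (F + L)], and this [th] makes the
   right side half of the left. *)
pose th := (F - L) / (2 * (F + L)).
have FL : 0 < 2 * (F + L) by lra.
have th0 : 0 < th by rewrite divr_gt0//; lra.
have th1 : th < 1 by rewrite ltr_pdivrMr//; lra.
have := key th ltac:(by rewrite th0).
rewrite lee_fin mulrAC ler_pdivrMr; last by lra.
have : th * (2 * (F + L)) = F - L by rewrite mulfVK// gt_eqF.
lra.
Qed.

Lemma qh_dist_triangle x y z : D x -> D y -> D z ->
  qh_dist D x z <= qh_dist D x y + qh_dist D y z.
Proof.
move=> Dx Dy Dz; rewrite -lerBlDl; apply: (local_lip_qh_dist (f := qh_dist D x)) => //.
move=> th p q /andP[th0 th1] Dp Dq pq; rewrite lerBlDl; apply: qh_dist_append => //.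
by rewrite ltW.
Qed.

Lemma qh_dist_sym x y : D x -> D y -> qh_dist D x y = qh_dist D y x.
Proof.
suff key p q : D p -> D q -> qh_dist D q p <= qh_dist D p q.
  by move=> Dx Dy; apply/le_anti; rewrite !key.
move=> Dp Dq; have := @local_lip_qh_dist (fun z => qh_dist D z p) p q.
rewrite qh_dist_xx// subr0; apply => // th u v /andP[th0 th1] Du Dv uv.
rewrite lerBlDr; apply: le_trans (qh_dist_triangle Dv Du Dp) _; rewrite lerD2r.
by apply: qh_dist_ballC => //; rewrite ltW.
Qed.

Lemma ln_bdist_lip x y : D x -> D y -> ln (bdist D y) - ln (bdist D x) <= qh_dist D x y.
Proof.
apply: (local_lip_qh_dist (f := fun z => ln (bdist D z))).
move=> th p q /andP[th0 th1] Dp Dq pq.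
have dp := bdist_gt0 bD oD Dp; have dq := bdist_gt0 bD oD Dq.
rewrite -ln_div ?posrE//.
have := bdist_lip q p bD; rewrite distrC => qp.
have -> : bdist D q / bdist D p = 1 + (bdist D q - bdist D p) / bdist D p.
  by rewrite mulrBl divff ?gt_eqF// addrCA subrr addr0.
apply: le_trans (le_ln1Dx _) _.
  by rewrite mulrBl divff ?gt_eqF// ltrBrDr addNr divr_gt0.
apply: (@le_trans _ _ (`|p - q| / bdist D p)); first by rewrite ler_pM2r ?invr_gt0//; lra.
rewrite ler_wpM2l// lef_pV2 ?posrE ?mulr_gt0//; last by lra.
by rewrite ler_piMl ?ltW//; lra.
Qed.

End QhDist.

(** * Halves of cone arcs *)

(** The last chord of a partition ends at [m]; by continuity it differs by less than [e] from a
    chord ending at some [t < m]. *)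
Lemma arc_length_lsc (R : realType) (E : completeNormedModType R) (g : R -> E)
    (a m l : R) : a <= m -> eps_continuous g a m -> 0 <= l ->
  (forall t, a <= t < m -> (arc_length g a t <= l%:E)%E) ->
  (arc_length g a m <= l%:E)%E.
Proof.
move=> am cg l0 hl; apply: arc_length_le => s; rewrite lee_fin.
case: (lastP s) => [//|{}s z] ps.
have := ps; rewrite /itv_partition last_rcons rcons_path => -[/andP[ps1 sz] /eqP zm].
rewrite {}zm {z ps} in sz *; rewrite -cats1 chord_sum_cat /= addr0.
have pl : itv_partition a (last a s) s by split.
have al := itv_partition_le pl.
apply/ler_addgt0Pr => e e0.
have [|h h0 hh] := cg m _ e e0; first by rewrite am lexx.
pose t := Num.max (m - h / 2) ((last a s + m) / 2).
have h2 : 0 < h / 2 by rewrite divr_gt0.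
have lm : last a s < (last a s + m) / 2 by lra.
have mm : (last a s + m) / 2 < m by lra.
have lt : last a s < t by rewrite /t lt_max lm orbT.
have tm : t < m by rewrite /t gt_max mm andbT; lra.
have th : m - h / 2 <= t by rewrite /t le_max lexx.
have at_ : a <= t by lra.
have /hl : a <= t < m by rewrite at_.
have := chord_sum2_le g pl (itv_partition1 lt).
move=> /le_trans /[apply]; rewrite lee_fin /= addr0 => h3.
have : `|g m - g t| < e.
  by apply: hh; rewrite ?at_ ?(ltW tm)// ger0_norm; lra.
by have := ler_distD (g t) (g m) (g (last a s)); lra.
Qed.

Section JohnHalf.
Context {R : realType} {E : completeNormedModType R} (D : set E).
Hypotheses (bD : boundary D !=set0) (oD : open D).
Hypothesis D_joined : forall x y, D x -> D y ->
  exists (g : R -> E) a b, [/\ curve_in D g a b, rectifiable g a b, g a = x & g b = y].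

(** The curve may cross itself and is then not admissible in [qh_dist]. The distance is accumulated
    over short segments with [th = 1 / 2], which is the source of the factor 2. *)
Lemma qh_dist_le_len (g : R -> E) (a b e : R) : curve_in D g a b ->
  rectifiable g a b -> 0 < e -> (forall t, a <= t <= b -> e <= bdist D (g t)) ->
  qh_dist D (g a) (g b) <= 2 * len g a b / e.
Proof.
move=> cg rg e0 he; have h0 : 0 < 1 / 2 :> R by [].
have ab : a <= b by case: cg.
have Da : D (g a) by apply: (curve_inP cg); rewrite lexx.
apply: (curve_ind (P := fun t => qh_dist D (g a) (g t) <= 2 * len g a t / e) bD oD cg h0).
  by rewrite qh_dist_xx// len_xx mulr0 mul0r.
move=> u t au /ltW ut tb IH near; have ub := le_trans ut tb.
have uab : a <= u <= b by rewrite au.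
have Du := curve_inP cg uab; have h1 : 0 <= (1 / 2 : R) < 1 by apply/andP; split; lra.
have gut : `|g u - g t| <= 1 / 2 * bdist D (g u).
  by rewrite distrC; apply: near; rewrite ut lexx.
apply: (le_trans (qh_dist_append bD oD D_joined Da Du h1 gut)).
rewrite (lenD au ut (rectifiable_sub (lexx a) (le_trans au ut) tb rg)).
rewrite mulrDr mulrDl lerD//.
have := chord_le_len ut (rectifiable_sub au ut tb rg); rewrite distrC => h2.
rewrite ler_pdivlMr// mulrAC ler_pdivrMr; last by rewrite mulr_gt0 ?bdist_gt0//; lra.
have h3 := he u uab; have l0 := len_ge0 g ut.
have n0 : 0 <= `|g u - g t| by [].
have h4 : `|g u - g t| * e <= len g u t * bdist D (g u) by apply: ler_pM => //; exact: ltW.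
by lra.
Qed.

Lemma cone_len_closed (g : R -> E) (a m c : R) : 0 <= c -> curve_in D g a m ->
  rectifiable g a m ->
  (forall t, a <= t < m -> len g a t <= c * bdist D (g t)) ->
  forall t, a <= t <= m -> len g a t <= c * bdist D (g t).
Proof.
move=> c0 cg rg hc t /andP[at_]; rewrite le_eqVlt => /predU1P[->|tm]; last first.
  by apply: hc; rewrite at_.
have am : a <= m by case: cg.
have ecg : eps_continuous g a m by apply/within_continuousP; case: cg.
have dm := bdist_gt0 bD oD (curve_inP cg (ltac:(by rewrite am lexx) : a <= m <= m)).
apply/ler_addgt0Pr => e e0; have ec : 0 < e / (c + 1) by rewrite divr_gt0// ltr_wpDl.
have [|h h0 hh] := ecg m _ _ ec; first by rewrite am lexx.
have cd0 : 0 <= c * bdist D (g m) by rewrite mulr_ge0// ltW.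
rewrite -lee_fin -lenE//; apply: arc_length_lsc => //; first by lra.
move=> u /andP[au um]; rewrite lenE//; last exact: (rectifiable_sub (lexx a) au (ltW um) rg).
pose s := Num.max u (m - h / 2).
have us : u <= s by rewrite /s le_max lexx.
have sm : s < m by rewrite /s gt_max um/=; lra.
have hs : m - h / 2 <= s by rewrite /s le_max lexx orbT.
have as_ := le_trans au us.
have gms : `|g m - g s| < e / (c + 1).
  apply: hh; first by rewrite as_ ltW.
  by rewrite ger0_norm; lra.
have := hc s (ltac:(by rewrite as_) : a <= s < m).
have rs := rectifiable_sub (lexx a) as_ (ltW sm) rg.
have := lenD au us rs; have := len_ge0 g us.
have h3 : c * bdist D (g s) <= c * (bdist D (g m) + e / (c + 1)).
  by rewrite ler_wpM2l//; have := bdist_lip (g s) (g m) bD; rewrite distrC; lra.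
have h4 : c * (e / (c + 1)) <= e.
  by rewrite mulrA ler_pdivrMr ?ltr_wpDl// mulrC ler_pM2l//; lra.
rewrite lee_fin; lra.
Qed.

(** With [r0] the boundary distance at [g a], the one at [g t] is at most [r0 + len g a t], and at
    least that divided by [1 + 2 * c]. A step has length at most [2 * (2 ^+ i * r0)], so
    [qh_dist_le_len] gives [4 * (1 + 2 * c)]. *)
Lemma john_half_growth (g : R -> E) (a m c : R) : 0 <= c -> curve_in D g a m ->
  rectifiable g a m ->
  (forall t, a <= t < m -> len g a t <= c * bdist D (g t)) ->
  exists (tau : nat -> R) n,
  [/\ forall i, a <= tau i <= m, g (tau 0%N) = g a, tau n = m,
      forall i, (i < n)%N -> qh_dist D (g (tau i)) (g (tau i.+1)) <= 4 * (1 + 2 * c) &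
      forall i j, (i <= j <= n)%N -> (j - i)%:R * ln 2 <=
        ln (bdist D (g (tau j))) - ln (bdist D (g (tau i))) + ln (2 * (1 + 2 * c))].
Proof.
move=> c0 cg rg /(cone_len_closed c0 cg rg) hc.
have am : a <= m by case: cg.
have ecg : eps_continuous g a m by apply/within_continuousP; case: cg.
have d_gt0 t : a <= t <= m -> 0 < bdist D (g t).
  by move=> tam; apply: bdist_gt0 => //; exact: (curve_inP cg).
set r0 := bdist D (g a).
have r00 : 0 < r0 by apply: d_gt0; rewrite lexx.
have r01 := ltW r00; have e2 i : 1 <= 2 ^+ i :> R by rewrite exprn_ege1// ler1n.
have rsub t : a <= t -> t <= m -> rectifiable g a t.
  by move=> at_ tm; exact: (rectifiable_sub (lexx a) at_ tm rg).
have len_mono u t : a <= u -> u <= t -> t <= m -> len g a u <= len g a t.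
  move=> au ut tm; rewrite (lenD au ut (rsub _ (le_trans au ut) tm)).
  by rewrite lerDl len_ge0.
have d_le t : a <= t <= m -> bdist D (g t) <= r0 + len g a t.
  move=> /andP[at_ tm]; have := bdist_lip (g t) (g a) bD.
  by have := chord_le_len at_ (rsub _ at_ tm); rewrite -/r0; lra.
have d_ge t : a <= t <= m -> r0 + len g a t <= (1 + 2 * c) * bdist D (g t).
  move=> tam; have /andP[at_ tm] := tam; have := bdist_lip (g a) (g t) bD.
  have := chord_le_len at_ (rsub _ at_ tm); have := hc t tam.
  by rewrite distrC -/r0; lra.
(* [tau i] will be the last time in [T i]. If [g] is constant at first, [tau 0] exceeds [a]; only
   [g (tau 0) = g a] is claimed. *)
pose T i := [set t | a <= t <= m /\ r0 + len g a t <= 2 ^+ i * r0].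
have Ta i : T i a.
  by split; [rewrite lexx|rewrite len_xx addr0 ler_peMl].
have Tsup i : has_sup (T i) by split; [exists a|exists m => t [/andP[]]].
pose tau i := sup (T i).
have tau_in i : a <= tau i <= m.
  apply/andP; split; first by apply: ub_le_sup => //; case: (Tsup i).
  by apply: ge_sup; [exists a|move=> t [/andP[]]].
have tau_gt i t : tau i < t -> t <= m -> 2 ^+ i * r0 < r0 + len g a t.
  move=> it tm; rewrite ltNge; apply/negP => h.
  have /(ub_le_sup (proj2 (Tsup i))) : T i t.
    split=> //; rewrite tm andbT; apply: ltW; apply: le_lt_trans it.
    by case/andP: (tau_in i).
  by rewrite leNgt it.
have tau_lt i t : a <= t -> t < tau i -> r0 + len g a t <= 2 ^+ i * r0.
  move=> at_ ti; have ti0 : 0 < tau i - t by rewrite subr_gt0.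
  have [s [/andP[as_ sm] hs]] := sup_adherent ti0 (Tsup i).
  rewrite -/(tau i) opprB addrC subrK => ts.
  by have := len_mono t s at_ (ltW ts) sm; lra.
have tau_len i : r0 + len g a (tau i) <= 2 ^+ i * r0.
  have /andP[ai im] := tau_in i.
  rewrite addrC -lerBrDr -lee_fin -lenE//; last exact: rsub.
  apply: arc_length_lsc => //.
  - exact: eps_continuous_sub ecg.
  - by rewrite subr_ge0 ler_peMl.
  - move=> t /andP[at_ ti]; have := tau_lt i t at_ ti.
    by rewrite lenE ?lee_fin//; [lra|apply: rsub => //; exact: le_trans (ltW ti) im].
have tau_d i : tau i < m -> 2 ^+ i * r0 <= (1 + 2 * c) * bdist D (g (tau i)).
  move=> im; apply/ler_addgt0Pr => e e0.
  have ec : 0 < e / (1 + 2 * c) by rewrite divr_gt0//; lra.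
  have [h h0 hh] := ecg (tau i) (tau_in i) _ ec.
  pose t := Num.min m (tau i + h / 2).
  have ti : tau i < t by rewrite /t lt_min im/=; lra.
  have tm : t <= m by rewrite /t ge_min lexx.
  have th : t <= tau i + h / 2 by rewrite /t ge_min lexx orbT.
  have /andP[ai _] := tau_in i; have at_ : a <= t by lra.
  have tam : a <= t <= m by rewrite at_.
  have gt : `|g (tau i) - g t| < e / (1 + 2 * c).
    by apply: hh => //; rewrite distrC ger0_norm; lra.
  have := tau_gt i t ti tm; have := d_ge t tam.
  have h1 : (1 + 2 * c) * bdist D (g t) <=
      (1 + 2 * c) * (bdist D (g (tau i)) + e / (1 + 2 * c)).
    rewrite ler_wpM2l//; first by lra.
    by have := bdist_lip (g t) (g (tau i)) bD; rewrite distrC; lra.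
  have h2 : (1 + 2 * c) * (e / (1 + 2 * c)) = e by rewrite mulrC divfK// gt_eqF//; lra.
  by lra.
have [i0 i0m] : exists i, tau i == m.
  have q0 : 0 <= (r0 + len g a m) / r0 by rewrite divr_ge0// addr_ge0// len_ge0.
  exists (Num.truncn ((r0 + len g a m) / r0)).+1; set i := _.+1.
  have /andP[_ im] := tau_in i; rewrite eq_le im/=; apply: ub_le_sup; first by case: (Tsup i).
  split; first by rewrite am lexx.
  rewrite -ler_pdivrMr//; apply: (le_trans (ltW (truncnS_gt _))).
  by rewrite -natrX ler_nat ltnW// ltn_expl.
pose P i := tau i == m; have [n /eqP nm nmin] := ex_minnP (ex_intro P i0 i0m).
have lt_m i : (i < n)%N -> tau i < m.
  move=> ni; rewrite lt_neqAle; have /andP[_ ->] := tau_in i; rewrite andbT.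
  by apply/negP => /nmin; rewrite leqNgt ni.
have c1 : 0 < 1 + 2 * c by lra.
(* The last step stops at [m], possibly before [r0 + len] has doubled; the extra factor 2 accounts
   for it. *)
have dlow i : (i <= n)%N -> 2 ^+ i * r0 <= 2 * (1 + 2 * c) * bdist D (g (tau i)).
  move=> ni; have cd : 0 <= (1 + 2 * c) * bdist D (g (tau i)).
    by rewrite mulr_ge0 ?ltW ?d_gt0.
  move: ni; rewrite leq_eqVlt => /predU1P[ein|/lt_m/tau_d]; last by lra.
  case: i => [|i] in ein cd *.
    have := d_ge _ (tau_in 0%N); have /andP[a0 _] := tau_in 0%N.
    by have := len_ge0 g a0; rewrite expr0; lra.
  have := tau_gt i m (lt_m i (ltac:(by rewrite -ein))) (lexx m).
  have tm : tau i.+1 = m by rewrite ein nm.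
  by have := d_ge _ (tau_in i.+1); rewrite tm exprS; lra.
have dup i : bdist D (g (tau i)) <= 2 ^+ i * r0.
  exact: le_trans (d_le _ (tau_in i)) (tau_len i).
exists tau, n; split=> //.
- have /andP[a0 t0m] := tau_in 0%N; have := chord_le_len a0 (rsub _ a0 t0m).
  have := tau_len 0%N; rewrite expr0 mul1r => h1 h2.
  by apply/eqP; rewrite -subr_eq0 -normr_le0; lra.
- move=> i ni; have iin := tau_in i; have Iin := tau_in i.+1.
  have /andP[ai im] := iin; have /andP[aI Im] := Iin.
  have iI : tau i <= tau i.+1.
    apply: ub_le_sup; first by case: (Tsup i.+1).
    split=> //; apply: (le_trans (tau_len i)).
    by rewrite exprS -mulrA ler_peMl ?mulr_ge0 ?exprn_ge0 ?ltW// ltr1n.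
  have e0 : 0 < 2 ^+ i * r0 / (1 + 2 * c) by rewrite divr_gt0// mulr_gt0// exprn_gt0.
  have he t : tau i <= t <= tau i.+1 -> 2 ^+ i * r0 / (1 + 2 * c) <= bdist D (g t).
    move=> /andP[it0 tI]; rewrite ler_pdivrMr// [leRHS]mulrC; move: it0.
    rewrite le_eqVlt => /predU1P[<-|it]; first exact: (tau_d i (lt_m i ni)).
    have tm := le_trans tI Im; have tam : a <= t <= m by rewrite tm (le_trans ai (ltW it)).
    by apply: le_trans (d_ge t tam); exact: ltW (tau_gt i t it tm).
  have cI := curve_in_sub ai iI Im cg; have rI := rectifiable_sub ai iI Im rg.
  apply: (le_trans (qh_dist_le_len cI rI e0 he)).
  have h1 : len g (tau i) (tau i.+1) <= 2 * (2 ^+ i * r0).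
    have := tau_len i.+1; rewrite (lenD ai iI (rsub _ aI Im)).
    by have := len_ge0 g ai; rewrite exprS; lra.
  rewrite ler_pdivrMr//.
  have -> : 4 * (1 + 2 * c) * (2 ^+ i * r0 / (1 + 2 * c)) = 4 * (2 ^+ i * r0).
    by field; rewrite gt_eqF.
  by lra.
- move=> i j /andP[ij jn]; have di := d_gt0 _ (tau_in i); have dj := d_gt0 _ (tau_in j).
  have h2 : 0 < 2 * (1 + 2 * c) by lra.
  have h3 : (j - i)%:R * ln 2 = ln (2 ^+ (j - i)) :> R by rewrite lnXn// mulr_natl.
  have p1 : 0 < 2 ^+ (j - i) :> R by rewrite exprn_gt0.
  have p2 : 0 < bdist D (g (tau j)) * (2 * (1 + 2 * c)) by rewrite mulr_gt0.
  have p3 : 0 < bdist D (g (tau j)) * (2 * (1 + 2 * c)) / bdist D (g (tau i)).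
    by rewrite divr_gt0.
  rewrite h3 addrAC -lnM ?posrE// -ln_div ?posrE// ler_ln ?posrE//.
  rewrite ler_pdivlMr//; have := dlow j jn; have := dup i => h4.
  rewrite -{1}(subnK ij) exprD => h5.
  have h6 : 2 ^+ (j - i) * bdist D (g (tau i)) <= 2 ^+ (j - i) * (2 ^+ i * r0).
    by rewrite ler_wpM2l// exprn_ge0.
  by lra.
Qed.

End JohnHalf.

(** * Midpoint of a cone arc and subdivision of a curve *)

Section ConeArcs.
Context {R : realType} {E : completeNormedModType R} (D : set E).
Hypotheses (bD : boundary D !=set0) (oD : open D).

Lemma curve_in_opp (g : R -> E) (a b : R) : curve_in D g a b ->
  curve_in D (g \o -%R) (- b) (- a).
Proof.
move=> [ab /within_continuousP cg gD]; split; first by rewrite lerN2.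
  apply/within_continuousP => t /andP[bt ta] e e0.
  have [|h h0 hh] := cg (- t) _ e e0; first by rewrite lerNr ta lerNl bt.
  exists h => // u /andP[bu ua] tu; apply: hh; first by rewrite lerNr ua lerNl bu.
  by rewrite opprK addrC distrC.
move=> _ [t + <-]; rewrite /= in_itv/= => /andP[bt ta]; apply: gD.
by exists (- t) => //=; rewrite in_itv/= lerNr ta lerNl bt.
Qed.

(** [m] is the supremum of the parameters whose first part is at most as long as the second. This
    decides the minimum in the cone condition on either side of [m]; [cone_len_closed] recovers the
    inequality at [m] itself. *)
Lemma cone_arc_middle (c : R) (g : R -> E) (a b : R) : cone_arc D c g a b ->
  exists m, [/\ a <= m <= b,
    forall t, a <= t < m -> len g a t <= c * bdist D (g t) &
    forall t, m < t <= b -> len g t b <= c * bdist D (g t)].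
Proof.
move=> [cg rg hc]; have ab : a <= b by case: cg.
have hc' t : a <= t <= b -> Num.min (len g a t) (len g t b) <= c * bdist D (g t).
  move=> tab; have /andP[at_ tb] := tab; have := hc t tab.
  rewrite (lenE at_ (rectifiable_sub (lexx a) at_ tb rg)).
  rewrite (lenE tb (rectifiable_sub at_ tb (lexx b) rg)).
  by rewrite -EFin_min lee_fin.
have len_mono u v : a <= u -> u <= v -> v <= b ->
    len g a u <= len g a v /\ len g v b <= len g u b.
  move=> au uv vb; have ub := le_trans uv vb; have av := le_trans au uv.
  rewrite (lenD au uv (rectifiable_sub (lexx a) av vb rg)).
  rewrite (lenD uv vb (rectifiable_sub au ub (lexx b) rg)).
  by have := len_ge0 g uv; lra.
pose T := [set t | a <= t <= b /\ len g a t <= len g t b].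
have Ta : T a by split; rewrite ?lexx// len_xx len_ge0.
have Tsup : has_sup T by split; [exists a|exists b => t [/andP[]]].
have am : a <= sup T by apply: ub_le_sup => //; case: Tsup.
have mb : sup T <= b by apply: ge_sup; [exists a|move=> t [/andP[]]].
exists (sup T); split; first by rewrite am.
- move=> t /andP[at_ tm]; have e0 : 0 < sup T - t by rewrite subr_gt0.
  have [s [/andP[as_ sb] hs]] := sup_adherent e0 Tsup.
  rewrite opprB addrC subrK => /ltW ts; have [h1 h2] := len_mono t s at_ ts sb.
  by have := hc' t; rewrite at_ (le_trans ts sb) min_l; [apply|lra].
- move=> t /andP[mt tb]; have at_ := le_trans am (ltW mt).
  have := hc' t; rewrite at_ tb min_r; first by apply.
  rewrite leNgt; apply/negP => /ltW h.
  have /(ub_le_sup (proj2 Tsup)) : T t by split; rewrite ?at_.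
  by rewrite leNgt mt.
Qed.

Lemma curve_bounded (g : R -> E) (a b : R) : curve_in D g a b ->
  exists2 M, 0 < M & forall t, a <= t <= b -> bdist D (g t) <= M.
Proof.
move=> cg; have ab : a <= b by case: cg.
have aab : a <= a <= b by rewrite lexx.
apply: (curve_ind (P := fun t => exists2 M, 0 < M &
  forall r, a <= r <= t -> bdist D (g r) <= M) bD oD cg ltr01).
  exists (bdist D (g a)); first by apply: bdist_gt0 => //; exact: (curve_inP cg).
  by move=> t /le_anti ->.
move=> u t au ut tb [M M0 hM] near; exists (2 * M); first by rewrite mulr_gt0.
move=> r /andP[ar rt]; have [ru|ur] := leP r u.
  by have := hM r; rewrite ar ru => /(_ isT); lra.
have := hM u; rewrite au lexx => /(_ isT).
by have := near r; rewrite (ltW ur) rt => /(_ isT); have := bdist_lip (g r) (g u) bD; lra.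
Qed.

Lemma rectifiable_qh (g : R -> E) (a b l : R) : curve_in D g a b ->
  (qh_length D g a b <= l%:E)%E -> rectifiable g a b.
Proof.
move=> cg hl; have [M M0 hM] := curve_bounded cg.
have ab : a <= b by case: cg.
have := le_trans (qh_length_ge bD oD cg M0 hM) hl; rewrite /rectifiable.
have := arc_length_ge0 g ab; case: (arc_length g a b) => [L| |]//.
  by rewrite ltry.
by rewrite mulry gtr0_sg ?invr_gt0// mul1e.
Qed.

(** A new point is placed once the curve has moved by more than 1/8 of the boundary distance at the
    current one. The last piece may be shorter, hence [i.+1 < N] in the lower bound. *)
Lemma curve_chain (g : R -> E) (a b : R) : curve_in D g a b ->
  exists (tau : nat -> R) N,
  [/\ (0 < N)%N, tau 0%N = a, tau N = b, forall i, a <= tau i <= b &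
      (forall i, (i < N)%N -> tau i <= tau i.+1 /\
         forall r, tau i <= r <= tau i.+1 ->
           `|g r - g (tau i)| <= 1 / 4 * bdist D (g (tau i))) /\
      (forall i, (i.+1 < N)%N ->
         1 / 8 * bdist D (g (tau i)) <= `|g (tau i.+1) - g (tau i)|)].
Proof.
move=> cg; have ab : a <= b by case: cg.
have d_gt0 t : a <= t <= b -> 0 < bdist D (g t).
  by move=> tab; apply: bdist_gt0 => //; exact: (curve_inP cg).
pose steps (tau : nat -> R) N := forall i, (i < N)%N ->
  [/\ tau i <= tau i.+1,
    forall r, tau i <= r <= tau i.+1 ->
      `|g r - g (tau i)| <= 1 / 4 * bdist D (g (tau i)) &
    1 / 8 * bdist D (g (tau i)) <= `|g (tau i.+1) - g (tau i)|].
pose P t := exists (tau : nat -> R) N, [/\ tau 0%N = a, forall i, a <= tau i <= t,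
  steps tau N & forall r, tau N <= r <= t ->
    `|g r - g (tau N)| <= 1 / 8 * bdist D (g (tau N))].
have : P b.
  (* Small enough that one step beyond 1/8 stays within 1/4, and that the rest of the step, seen
     from the new point, stays within 1/8. *)
  have e0 : 0 < 1 / 20 :> R by [].
  apply: (curve_ind (P := P) bD oD cg e0).
    exists (fun=> a), 0%N; split => // [i|r /le_anti <-]; first by rewrite lexx.
    have := d_gt0 a; rewrite lexx ab => /(_ isT); rewrite subrr normr0; lra.
  move=> u t au ut tb [tau [N [tau0 tau_in st last_]]] near.
  have /andP[aN Nu] := tau_in N.
  have dN : 0 < bdist D (g (tau N)).
    by apply: d_gt0; rewrite aN (le_trans Nu)// (le_trans (ltW ut)).
  have gu : `|g u - g (tau N)| <= 1 / 8 * bdist D (g (tau N)).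
    by apply: last_; rewrite Nu lexx.
  have du := bdist_lip (g u) (g (tau N)) bD.
  have near4 r : tau N <= r <= t -> `|g r - g (tau N)| <= 1 / 4 * bdist D (g (tau N)).
    move=> /andP[Nr rt]; have [ru|ur] := leP r u.
      by have := last_ r; rewrite Nr ru => /(_ isT); lra.
    have := near r; rewrite (ltW ur) rt => /(_ isT).
    by have := ler_distD (g u) (g r) (g (tau N)); lra.
  have [all8|] := pselect (forall r, tau N <= r <= t ->
      `|g r - g (tau N)| <= 1 / 8 * bdist D (g (tau N))).
    exists tau, N; split => // i; have /andP[-> iu] := tau_in i.
    exact: le_trans iu (ltW ut).
  move=> /existsNP[r /not_implyP[/andP[Nr rt] /negP]]; rewrite -ltNge => gr.
  have ur : u < r.
    rewrite ltNge; apply/negP => ru; have := last_ r.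
    by rewrite Nr ru => /(_ isT); lra.
  exists (fun i => if (i <= N)%N then tau i else r), N.+1; split => //.
  - move=> i; case: ifP => _; last by rewrite (le_trans au (ltW ur)).
    by have /andP[-> iu] := tau_in i; exact: le_trans iu (ltW ut).
  - move=> i; rewrite ltnS => iN; rewrite iN.
    move: (iN); rewrite leq_eqVlt => /predU1P[->|iltN].
      rewrite ltnn; split => //; last exact: ltW.
      by move=> s /andP[Ns sr]; apply: near4; rewrite Ns (le_trans sr).
    by rewrite iltN; exact: st.
  - rewrite ltnn => s /andP[rs st_].
    have h1 := near r; have h2 := near s.
    rewrite (ltW ur) rt in h1; rewrite (le_trans (ltW ur) rs) st_ in h2.
    have {}h1 := h1 isT; have {}h2 := h2 isT.
    have dr := d_gt0 r (ltac:(by rewrite (le_trans au (ltW ur)) (le_trans rt tb)) : a <= r <= b).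
    have := ler_distD (g u) (g s) (g r); rewrite (distrC (g u) (g r)).
    by have := bdist_lip (g u) (g r) bD; rewrite (distrC (g u) (g r)); lra.
move=> [tau [N [tau0 tau_in st last_]]].
exists (fun i => if (i <= N)%N then tau i else b), N.+1; split => //=.
- by rewrite ltnn.
- by move=> i; case: ifP => _ //; rewrite ab lexx.
split=> i.
- rewrite ltnS => iN; rewrite iN; move: (iN); rewrite leq_eqVlt => /predU1P[->|iltN].
    rewrite ltnn; have /andP[aN Nb] := tau_in N; split => // r /last_.
    have := d_gt0 _ (tau_in N); lra.
  by rewrite iltN; have [? ? _] := st i iltN.
- rewrite ltnS => iN; rewrite iN (ltnW iN).
  by have [_ _] := st i iN.
Qed.

End ConeArcs.

(** * Quasigeodesics in Gromov hyperbolic John domains *)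

Section Quasigeodesics.
Context {R : realType} {E : completeNormedModType R} (D : set E).
Hypotheses (bD : boundary D !=set0) (oD : open D).
Hypothesis D_joined : forall x y, D x -> D y ->
  exists (g : R -> E) a b, [/\ curve_in D g a b, rectifiable g a b, g a = x & g b = y].

(** The metric properties of [qh_dist] are available for points of [D], whence the subtype. *)
Lemma gromov_hyperbolic_dist (delta : R) : gromov_hyperbolic D delta ->
  hyperbolic_dist (fun x y : {x | D x} => qh_dist D (sval x) (sval y)) delta.
Proof.
move=> hD; split.
- by move=> [x Dx]; exact: qh_dist_xx.
- by move=> [x Dx] [y Dy]; exact: qh_dist_sym.
- by move=> [x Dx] [y Dy] [z Dz]; exact: qh_dist_triangle.
move=> [w Dw] [x Dx] [y Dy] [z Dz] /=.
have := hD x y z w Dx Dy Dz Dw; rewrite /gromov_product.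
by rewrite /Num.min; case: ifP => _ h; [left|right]; lra.
Qed.

Lemma nondecreasing_upto (tau : nat -> R) N :
  (forall i, (i < N)%N -> tau i <= tau i.+1) ->
  forall i j, (i <= j <= N)%N -> tau i <= tau j.
Proof.
move=> ht i j /andP[]; elim: j => [|j IH]; first by rewrite leqn0 => /eqP ->.
rewrite leq_eqVlt => /predU1P[->//|]; rewrite ltnS => ij jN.
exact: le_trans (IH ij (ltnW jN)) (ht j jN).
Qed.

(** On a piece the boundary distance is at most 5/4 of its initial value, and each piece but the
    last has length at least 1/8 of it, hence quasihyperbolic length at least 1/10: this gives the
    factor 10, and the last piece the 1. The same 5/4 turns quasihyperbolic length at most [c0] into
    arc length. *)
Lemma quasigeodesic_chain (c0 : R) (g : R -> E) (a b : R) : 1 <= c0 ->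
  quasigeodesic D c0 g a b -> exists (tau : nat -> R) N,
  [/\ [/\ (0 < N)%N, tau 0%N = a, tau N = b, forall i, a <= tau i <= b &
        forall i, (i < N)%N -> tau i <= tau i.+1],
      forall i, (i < N)%N -> qh_dist D (g (tau i)) (g (tau i.+1)) <= 1,
      forall i j, (i <= j <= N)%N ->
        (j - i)%:R <= 10 * c0 * qh_dist D (g (tau i)) (g (tau j)) + 1,
      forall i, (i < N)%N -> len g (tau i) (tau i.+1) <= 2 * c0 * bdist D (g (tau i)) &
      forall i t, (i < N)%N -> tau i <= t <= tau i.+1 ->
        bdist D (g (tau i)) <= 2 * bdist D (g t)].
Proof.
move=> c01 [cg hq]; have ab : a <= b by case: cg.
have rg : rectifiable g a b := rectifiable_qh bD oD cg (hq a b (lexx a) ab (lexx b)).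
have [tau [N [N0 tau0 tauN tau_in [st st8]]]] := curve_chain bD oD cg.
have le_tau i : (i < N)%N -> tau i <= tau i.+1 by move=> /st[].
have Dtau i := curve_inP cg (tau_in i).
have d_gt0 i := bdist_gt0 bD oD (Dtau i).
have mono := nondecreasing_upto le_tau.
have q1 i : (i < N)%N -> qh_dist D (g (tau i)) (g (tau i.+1)) <= 1.
  move=> iN; have [ti near] := st i iN.
  have h : `|g (tau i) - g (tau i.+1)| <= 1 / 4 * bdist D (g (tau i)).
    by rewrite distrC; apply: near; rewrite ti lexx.
  have th : 0 <= (1 / 4 : R) < 1 by apply/andP; split; lra.
  apply: (le_trans (qh_dist_ball bD oD D_joined (Dtau i) th h)).
  have d0 := d_gt0 i; rewrite ler_pdivrMr; last by rewrite mulr_gt0//; lra.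
  by lra.
have step_up i t : (i < N)%N -> tau i <= t <= tau i.+1 ->
    bdist D (g t) <= 5 / 4 * bdist D (g (tau i)).
  by move=> /st[_ near] /near; have := bdist_lip (g t) (g (tau i)) bD; lra.
have csub i j (ij : tau i <= tau j) : curve_in D g (tau i) (tau j).
  by have /andP[? _] := tau_in i; have /andP[_ ?] := tau_in j; exact: curve_in_sub cg.
have rsub i j (ij : tau i <= tau j) : rectifiable g (tau i) (tau j).
  by have /andP[? _] := tau_in i; have /andP[_ ?] := tau_in j; exact: rectifiable_sub rg.
have q_count i j : (i <= j < N)%N ->
    (((j - i)%:R / 10)%:E <= qh_length D g (tau i) (tau j))%E.
  move=> /andP[]; elim: j => [|j IH].
    by rewrite leqn0 => /eqP -> _; rewrite subnn mul0r qh_length_ge0.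
  rewrite leq_eqVlt => /predU1P[<- _|]; first by rewrite subnn mul0r qh_length_ge0.
  rewrite ltnS => ij jN; have jN' := ltnW jN; have jj := le_tau j jN'.
  have ijt : tau i <= tau j by apply: mono; rewrite ij ltnW.
  have ijt' := le_trans ijt jj.
  have M0 : 0 < 5 / 4 * bdist D (g (tau j)) by rewrite mulr_gt0//; lra.
  apply: le_trans (qh_length_add_ge bD oD (csub _ _ ijt') (rsub _ _ ijt') ijt jj M0
    (fun t => step_up j t jN')).
  rewrite subSn// -[(j - i).+1%:R]natr1 mulrDl EFinD; apply: leeD; first exact: (IH ij jN').
  rewrite lee_fin ler_pdivlMr//; have := st8 j jN.
  by have := chord_le_len jj (rsub _ _ jj); have := d_gt0 j; lra.
have qle i j : (i <= j <= N)%N ->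
    (qh_length D g (tau i) (tau j) <= (c0 * qh_dist D (g (tau i)) (g (tau j)))%:E)%E.
  by move=> /mono ij; apply: hq => //; [case/andP: (tau_in i)|case/andP: (tau_in j)].
exists tau, N; split=> //.
- move=> i j ijN; have := qle i j ijN; move/andP: ijN => [ij jN].
  have [->|nij] := eqVneq i j.
    have h0 := qh_dist_ge0 D (g (tau j)) (g (tau j)).
    have : 0 <= 10 * c0 * qh_dist D (g (tau j)) (g (tau j)) by rewrite mulr_ge0//; lra.
    by rewrite subnn; lra.
  case: j => [|j] in ij jN nij *; first by rewrite leqn0 (negPf nij) in ij.
  have ij1 : (i <= j)%N by rewrite -ltnS ltn_neqAle nij.
  have := q_count i j; rewrite ij1 jN => /(_ isT) h1 h2.
  have t1 : tau i <= tau j by apply: mono; rewrite ij1 ltnW.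
  have t2 := le_tau j jN; have t3 := le_trans t1 t2.
  have h3 := qh_length_prefix_le bD oD (csub _ _ t3) (rsub _ _ t3) t1 t2.
  have := le_trans h1 (le_trans h3 h2); rewrite lee_fin.
  by rewrite subSn// -[(j - i).+1%:R]natr1; lra.
- move=> i iN; have ti := le_tau i iN.
  have M0 : 0 < 5 / 4 * bdist D (g (tau i)) by rewrite mulr_gt0//; have := d_gt0 i; lra.
  have := qh_length_ge bD oD (csub _ _ ti) M0 (fun t => step_up i t iN).
  have := qle i i.+1; rewrite leqnSn iN => /(_ isT) h1 h2.
  have := le_trans h2 h1; rewrite lenE//; last exact: rsub.
  rewrite -EFinM lee_fin => h3.
  have : c0 * qh_dist D (g (tau i)) (g (tau i.+1)) <= c0 by rewrite ler_piMr ?q1//; lra.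
  move=> /(le_trans h3); rewrite mulrC ler_pdivrMr// => h4; apply: (le_trans h4).
  have : 0 <= c0 * bdist D (g (tau i)) by rewrite mulr_ge0 ?ltW//; lra.
  by lra.
- move=> i t /st[_ near] /near; have := bdist_lip (g (tau i)) (g t) bD.
  by rewrite distrC; have := d_gt0 i; lra.
Qed.

(** [A] is left free so that one constant can serve the cone arc and the quasigeodesic. *)
Lemma john_growth_chain (c : R) (g : R -> E) (a m A : R) : 1 <= c ->
  (ln 2)^-1 <= A -> curve_in D g a m -> rectifiable g a m ->
  (forall t, a <= t < m -> len g a t <= c * bdist D (g t)) ->
  exists (w : nat -> {x | D x}) n,
  [/\ sval (w 0%N) = g a, sval (w n) = g m &
    gchain (fun x y => qh_dist D (sval x) (sval y)) (fun x => ln (bdist D (sval x)))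
      (4 * (1 + 2 * c) + 1) A (A * ln (2 * (1 + 2 * c)) + 1) w n].
Proof.
move=> c1 hA cg rg hc; have c0 : 0 <= c by lra.
have [tau [n [tau_in tau0 taun st gr]]] := john_half_growth bD oD D_joined c0 cg rg hc.
exists (fun i => exist D (g (tau i)) (curve_inP cg (tau_in i))), n; split => //=.
  by rewrite taun.
split=> [i /st /=|i j /gr /=]; first by lra.
have l2 : 0 < ln 2 :> R by rewrite ln_gt0// ltr1n.
have A0 : 0 < A by apply: lt_le_trans hA; rewrite invr_gt0.
set X := _ - _; set L := ln (2 * _) => h.
have XL : 0 <= X + L by apply: le_trans h; rewrite mulr_ge0// ltW.
rewrite -ler_pdivlMr// in h; apply: (le_trans h).
have : (X + L) / ln 2 <= (X + L) * A by rewrite ler_wpM2l.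
by lra.
Qed.

End Quasigeodesics.

Lemma sval_inj (T : Type) (P : T -> Prop) (u v : {x | P x}) : sval u = sval v -> u = v.
Proof.
by case: u v => [x Px] [y Py] /= e; subst y; congr exist; exact: Prop_irrelevance.
Qed.

Theorem theorem3p1 (R : realType) (delta c c0 : R)
    (delta_gt0 : 0 < delta) (c_ge1 : 1 <= c) (c0_ge1 : 1 <= c0) :
  exists c2 : R, 1 <= c2 /\
    forall (E : completeNormedModType R) (D : set E),
      dim_ge2 E -> domain D -> D <> setT ->
      gromov_hyperbolic D delta -> john D c ->
      forall (g : R -> E) (a b : R),
        quasigeodesic D c0 g a b -> cone_arc D c2 g a b.
Proof.
have l2 : 0 < ln 2 :> R by rewrite ln_gt0// ltr1n.
have l2' : 0 < (ln 2)^-1 :> R by rewrite invr_gt0.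
pose S : R := 4 * (1 + 2 * c) + 1; pose A := 10 * c0 + (ln 2)^-1.
pose B := A * ln (2 * (1 + 2 * c)) + 1.
have S0 : 0 < S by rewrite /S; lra.
have A0 : 0 < A by rewrite /A; lra.
have B1 : 1 <= B by rewrite /B lerDr mulr_ge0 ?ltW// ln_gt0//; lra.
have B0 : 0 <= B by lra.
have [A' [B' [A'0 B'0 tripod]]] := tripod_growth delta_gt0 S0 A0 B0.
(* Up to an additive constant, the logarithm of [bdist] changes by at least [A'^-1] per index, so
   [q] is the ratio of the geometric series. *)
pose q := expR (- A'^-1).
have q0 : 0 < q by exact: expR_gt0.
have q1 : q < 1 by rewrite /q expR_lt1 oppr_lt0 invr_gt0.
(* A piece is at most [2 * c0] times the boundary distance at its start; another 2 passes from
   [tau l] to [t], the exponential absorbs [B'], and [1 - q] sums the series. *)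
pose K := 4 * c0 * expR (B' / A') / (1 - q).
have K0 : 0 <= K.
  by rewrite /K divr_ge0 ?mulr_ge0 ?expR_ge0//; lra.
exists (1 + K); split; first by lra.
move=> E D _ [[x0 Dx0] oD _] DT hD jD g a b qg.
have bD : boundary D !=set0 by apply: boundary_nonempty => //; exists x0.
have D_joined x y : D x -> D y -> exists (g : R -> E) a b,
    [/\ curve_in D g a b, rectifiable g a b, g a = x & g b = y].
  move=> Dx Dy; have [f [u [v [[cf rf _] fu fv]]]] := jD x y Dx Dy.
  by exists f, u, v.
have cg : curve_in D g a b by case: qg.
have ab : a <= b by case: cg.
have rg : rectifiable g a b.
  by case: qg => _ /(_ a b (lexx a) ab (lexx b)); exact: rectifiable_qh.
have [tau [N [[N0 tau0 tauN tau_in tau_le] step1 count steplen stepd]]] :=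
  quasigeodesic_chain bD oD D_joined c0_ge1 qg.
have hyp := gromov_hyperbolic_dist bD oD D_joined hD.
pose X := {x | D x}; pose k (x y : X) := qh_dist D (sval x) (sval y).
pose rho (x : X) := ln (bdist D (sval x)).
have rho_lip (x y : X) : rho y - rho x <= k x y.
  by apply: ln_bdist_lip => //; [case: x|case: y].
pose p i : X := exist D (g (tau i)) (curve_inP cg (tau_in i)).
have qp : qchain k S A B p N.
  split=> [i iN|i j ijN]; first by apply: (le_trans (step1 i iN)); rewrite /S; lra.
  apply: (le_trans (count i j ijN)); apply: lerD => //.
  by rewrite ler_wpM2r ?qh_dist_ge0// /A; lra.
have Da : D (g a) by apply: (curve_inP cg); rewrite lexx.
have Db : D (g b) by apply: (curve_inP cg); rewrite ab lexx.
have [f [u [v [cone fu fv]]]] := jD _ _ Da Db.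
have [m [/andP[um mv] hl hr]] := cone_arc_middle cone.
have [cf rf _] := cone.
have hA : (ln 2)^-1 <= A by rewrite /A; lra.
have [w [n [w0 wn gw]]] := john_growth_chain bD oD D_joined c_ge1 hA
  (curve_in_sub (lexx u) um mv cf) (rectifiable_sub (lexx u) um mv rf) hl.
(* The second half is reversed, so that its growth chain starts at [g b] and ends at the common
   point [f m]. *)
have rf' : rectifiable (f \o -%R) (- v) (- m).
  by rewrite /rectifiable arc_length_opp//; exact: (rectifiable_sub um mv (lexx v) rf).
have hr' t : - v <= t < - m -> len (f \o -%R) (- v) t <= c * bdist D ((f \o -%R) t).
  move=> /andP[vt tm]; have tv : - t <= v by rewrite lerNl.
  have := hr (- t); rewrite tv andbT ltrNr => /(_ tm).
  by rewrite /len -(arc_length_opp f tv) opprK.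
have [w' [n' [w'0 w'n gw']]] := john_growth_chain bD oD D_joined c_ge1 hA
  (curve_in_opp (curve_in_sub um mv (lexx v) cf)) rf' hr'.
have e0 : w 0%N = p 0%N by apply: sval_inj; rewrite w0 fu /= tau0.
have e1 : w' 0%N = p N by apply: sval_inj; rewrite w'0 /= opprK fv tauN.
have e2 : w n = w' n' by apply: sval_inj; rewrite wn w'n /= opprK.
have tri := tripod X k rho hyp rho_lip p N w n w' n' qp gw e0 gw' e1 e2.
have d_gt0 i : 0 < bdist D (g (tau i)).
  by apply: bdist_gt0 => //; exact: (curve_inP cg (tau_in i)).
pose K1 l := 2 * c0 * expR (B' / A') * bdist D (g (tau l)).
have K10 l : 0 <= K1 l by rewrite /K1 !mulr_ge0 ?expR_ge0 ?ltW//; lra.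
have decay l j (r : nat) : r%:R <= A' * (rho (p l) - rho (p j)) + B' ->
    2 * c0 * bdist D (g (tau j)) <= K1 l * q ^+ r.
  rewrite /rho /= => h; rewrite /K1 -!mulrA ler_wpM2l// ler_wpM2l//; first by lra.
  rewrite /q -expRM_natl -[leLHS]lnK ?posrE// -[bdist D (g (tau l))]lnK ?posrE//.
  rewrite -!expRD ler_expR.
  have : (r%:R - B') / A' <= ln (bdist D (g (tau l))) - ln (bdist D (g (tau j))).
    by rewrite ler_pdivrMr//; lra.
  by rewrite ?mulrN; lra.
have q1' : 0 < 1 - q by lra.
split=> // t /andP[at_ tb].
have [l [lN tl lt]] : exists l, [/\ (l < N)%N, tau l <= t & t <= tau l.+1].
  have : t <= tau N by rewrite tauN.
  move: (N) N0 => M; elim: M => // M IH _; have [tM|Mt] := leP t (tau M).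
    case: M IH tM => [_ _ h|M IH tM _]; first by exists 0%N; rewrite tau0.
    by have [l [lM ? ?]] := IH isT tM; exists l; rewrite ltnW.
  by move=> tM; exists M; split => //; exact: ltW.
have rtau i j (ij : tau i <= tau j) : rectifiable g (tau i) (tau j).
  by have /andP[? _] := tau_in i; have /andP[_ ?] := tau_in j; exact: rectifiable_sub rg.
have mono := nondecreasing_upto tau_le.
have bound (x : R) : x <= K1 l / (1 - q) -> (x%:E <= ((1 + K) * bdist D (g t))%:E)%E.
  move=> h; rewrite lee_fin; apply: (le_trans h).
  have dl := stepd l t lN; rewrite tl lt in dl; have {}dl := dl isT.
  have d0 : 0 < bdist D (g t) by have := d_gt0 l; lra.
  apply: (@le_trans _ _ (K * bdist D (g t))); last by rewrite ler_pM2r//; lra.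
  rewrite /K1 /K [leRHS]mulrAC ler_pM2r ?invr_gt0//.
  have ce : 0 <= 2 * c0 * expR (B' / A') by rewrite mulr_ge0 ?expR_ge0//; lra.
  by have := ler_wpM2l ce dl; lra.
have K1l := K10 l; have q0' := ltW q0; have q1'' := ltW q1'.
rewrite ge_min; apply/orP; have [left_|right_] := tri l (ltnW lN); [left|right].
(* The bound is the full tail of the series, which makes the induction exact. It runs up to [l.+1]
   because [t] lies in the piece that ends at [tau l.+1]. *)
- have key j : (j <= l.+1)%N -> len g a (tau j) <= K1 l * q ^+ (l.+1 - j) / (1 - q).
    elim: j => [_|j IH jl].
      by rewrite tau0 len_xx divr_ge0// mulr_ge0// exprn_ge0.
    have jN : (j < N)%N by exact: leq_trans lN.
    have jj := tau_le j jN; have /andP[aj _] := tau_in j.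
    have aj1 : rectifiable g a (tau j.+1) by rewrite -tau0; apply: rtau; rewrite tau0 (le_trans aj).
    rewrite (lenD aj jj aj1) subSS.
    have := IH (ltnW jl); rewrite subSn// => h1.
    have := le_trans (steplen j jN) (decay _ _ _ (left_ j jl)) => h2.
    apply: (le_trans (lerD h1 h2)); rewrite le_eqVlt; apply/orP; left; apply/eqP.
    by rewrite exprS; field; rewrite gt_eqF.
  have := key l.+1 (leqnn _); rewrite subnn expr0 mulr1 => h.
  apply: le_trans (bound _ h); rewrite -lenE.
  + exact: arc_length_lel.
  + by rewrite (le_trans at_).
  + by rewrite -tau0; apply: rtau; rewrite tau0 (le_trans at_).
(* Here the arc after [t] is part of the arc after [tau l], and the terms decrease with [j], so the
   exact partial sum is carried along. *)
- have key j : (l <= j <= N)%N ->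
      len g (tau l) (tau j) <= K1 l * (1 - q ^+ (j - l)) / (1 - q).
    move=> /andP[]; elim: j => [|j IH].
      by rewrite leqn0 => /eqP -> _; rewrite len_xx subnn expr0 subrr mulr0 mul0r.
    rewrite leq_eqVlt => /predU1P[<- _|].
      by rewrite len_xx subnn expr0 subrr mulr0 mul0r.
    rewrite ltnS => lj jN.
    have jj := tau_le j jN; have ljt : tau l <= tau j by apply: mono; rewrite lj ltnW.
    rewrite (lenD ljt jj (rtau _ _ (le_trans ljt jj))) subSn//.
    have h1 := IH lj (ltnW jN).
    have h2 := le_trans (steplen j jN) (decay _ _ _ (right_ j (ltac:(by rewrite lj ltnW)))).
    apply: (le_trans (lerD h1 h2)); rewrite le_eqVlt; apply/orP; left; apply/eqP.
    by rewrite exprS; field; rewrite gt_eqF.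
  have := key N; rewrite (ltnW lN) leqnn tauN => /(_ isT) h.
  have lb : tau l <= b by case/andP: (tau_in l).
  have rl : rectifiable g (tau l) b by rewrite -tauN; apply: rtau; rewrite tauN.
  apply: (@le_trans _ _ (len g (tau l) b)%:E).
    by rewrite -lenE//; exact: arc_length_ler.
  apply: bound; apply: (le_trans h).
  by rewrite ler_pM2r ?invr_gt0// ler_piMr// lerBlDr lerDl exprn_ge0.
Qed.
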